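(* Let $\ell\in\mathbb{N}$ and $p>1$. Suppose that $\mathfrak{g}\in H^\ell$ satisfies $$\nabla^k\mathfrak{g}_n>0\quad\text{for all } n\ge\ell \text{ and } k\in\{0,\dots,\ell\},$$ $$-\Delta_p^{(\ell-k)}\nabla^{k}\mathfrak{g}_{n}\ge 0\quad\text{for all } n\ge\ell \text{ and } k\in\{1,\dots,\ell-1\},$$ $$-\Delta_p^{(\ell)}\mathfrak{g}_n>0\quad\text{for all } n\ge\ell.$$ In addition, suppose that $\mathfrak{g}$ admits the asymptotic expansion $$\mathfrak{g}_{n}=\sum_{j=0}^{2\ell}\alpha_{j}\,n^{\ell-j-1/p}+\mathcal{O}\bigl(n^{-\ell-1-1/p}\bigr),\quad\text{as } n\to\infty,$$ for some $\alpha_{j}\in\mathbb{R}$ with $\alpha_{0}\neq0$. Then the sequence $\rho(\mathfrak{g})=\{\rho_n(\mathfrak{g})\}_{n\ge\ell}$, $\rho_n(\mathfrak{g}):=\dfrac{-\Delta_p^{(\ell)}\mathfrak{g}_n}{\mathfrak{g}_n^{p-1}}$, is an optimal discrete $p$-Hardy--Rellich--Birman weight (of order $\ell$).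
   Context: $\mathbb{N}=\{1,2,\dots\}$. $C(\mathbb{Z})$ is the space of complex sequences indexed by $\mathbb{Z}$, and $C_0(\mathbb{Z})$ its subspace of finitely supported sequences. For $u\in C(\mathbb{Z})$ put $\nabla u_n=(\nabla u)_n:=u_n-u_{n-1}$ and $\mathrm{div}\,u_n=(\mathrm{div}\,u)_n:=u_{n+1}-u_n$, $n\in\mathbb{Z}$; the $0$-th power of an operator is the identity. For $m\in\mathbb{N}$, $H^m:=\{u\in C(\mathbb{Z}) : u_n=0 \text{ for all } n<m\}$ and $\mathcal{H}_0^m:=H^m\cap C_0(\mathbb{Z})$. For $\nu\in\mathbb{C}$ and $a>0$, $\nu^{\langle a\rangle}:=\nu|\nu|^{a-1}$ with $0^{\langle a\rangle}:=0$ (applied entrywise to sequences). For an integer $m\ge0$, the discrete $p$-Laplacian of order $m$ is $-\Delta_p^{(m)}u:=(-1)^m\,\mathrm{div}^m\bigl((\nabla^m u)^{\langle p-1\rangle}\bigr)$; in particular $-\Delta_p^{(0)}u=u^{\langle p-1\rangle}$. The expression $-\Delta_p^{(m)}\nabla^k\mathfrak{g}_n$ denotes the value at $n$ of $-\Delta_p^{(m)}$ applied to the sequence $\nabla^k\mathfrak{g}$. A non-negative sequence $\rho=\{\rho_n\}_{n=\ell}^\infty$ is a discrete $p$-Hardy--Rellich--Birman weight if $$(\ast)\qquad\sum_{n=\ell}^{\infty}\bigl|\nabla^\ell u_n\bigr|^p\ge\sum_{n=\ell}^{\infty}\rho_n|u_n|^p$$ holds for all $u\in\mathcal{H}_0^\ell$.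 Such a weight $\rho$ is optimal if it has the following three properties: (i) Criticality: for any discrete $p$-Hardy--Rellich--Birman weight $\tilde\rho$ with $\tilde\rho_n\ge\rho_n$ for all $n\ge\ell$, it follows that $\tilde\rho=\rho$. (ii) Non-attainability: whenever equality in $(\ast)$ is attained for some $u\in H^\ell$ such that the right-hand side of $(\ast)$ is finite, then $u\equiv0$. (iii) Optimality near infinity: for any $m\ge\ell$ and $\varepsilon>0$ there exists $u\in\mathcal{H}_0^m$ such that $\sum_{n=\ell}^{\infty}|\nabla^\ell u_n|^p<(1+\varepsilon)\sum_{n=\ell}^{\infty}\rho_n|u_n|^p$. *)

(* Defs.v *)
From HB Require Import structures.
From mathcomp Require Import all_boot all_order all_algebra.
From mathcomp Require Import complex.
From mathcomp Require Import all_classical all_reals all_analysis.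
Set Implicit Arguments.
Unset Strict Implicit.
Unset Printing Implicit Defensive.
Import Order.TTheory GRing.Theory Num.Theory.
Import numFieldNormedType.Exports.
Local Open Scope classical_set_scope.
Local Open Scope ring_scope.
Local Open Scope complex_scope.

(* The modulus of a complex number as an element of R; the generic [`|z|]
   takes its values in R[i]. *)
Notation cmod := ComplexField.Normc.normc.

Definition nabla (V : zmodType) (u : int -> V) : int -> V :=
  fun n => u n - u (n - 1).

Definition dive (V : zmodType) (u : int -> V) : int -> V :=
  fun n => u (n + 1) - u n.

(* nu |-> nu |nu|^(a-1). Since [0 `^ b] is 0 or 1, the value at nu = 0 is 0
   for every a. *)
Definition signed_pow (R : realType) (a : R) (z : R[i]) : R[i] :=
  z * (cmod z `^ (a - 1))%:C.

(* [pLap p m] is the operator - Delta_p^(m); the leading minus sign is part of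
   it. *)
Definition pLap (R : realType) (p : R) (m : nat) (u : int -> R[i]) :
    int -> R[i] :=
  fun n => (-1) ^+ m *
    iter m (@dive R[i]) (fun k => signed_pow (p - 1) (iter m (@nabla R[i]) u k)) n.

Definition Hseq (R : realType) (m : nat) : set (int -> R[i]) :=
  [set u | forall n : int, n < m%:Z -> u n = 0].

Definition H0seq (R : realType) (m : nat) : set (int -> R[i]) :=
  [set u | Hseq m u /\ finite_set [set n : int | u n != 0]].

(* Both sums have non-negative terms (for the second one, as soon as rho is
   non-negative on n >= l) and take their values in [0, +oo]. *)
Definition birman_lhs (R : realType) (p : R) (l : nat) (u : int -> R[i]) :
    \bar R :=
  (\sum_(l <= n <oo) (cmod (iter l (@nabla R[i]) u n%:Z) `^ p)%:E)%E.

Definition birman_rhs (R : realType) (p : R) (l : nat) (rho : nat -> R)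
    (u : int -> R[i]) : \bar R :=
  (\sum_(l <= n <oo) (rho n * cmod (u n%:Z) `^ p)%:E)%E.

(* A sequence indexed by n >= l is encoded as a function on nat whose values
   at n < l are irrelevant. *)
Definition is_HRB_weight (R : realType) (p : R) (l : nat) (rho : nat -> R) :
    Prop :=
  (forall n : nat, (l <= n)%N -> 0 <= rho n) /\
  (forall u : int -> R[i], H0seq l u ->
     (birman_rhs p l rho u <= birman_lhs p l u)%E).

Definition critical (R : realType) (p : R) (l : nat) (rho : nat -> R) : Prop :=
  forall rho' : nat -> R, is_HRB_weight p l rho' ->
    (forall n : nat, (l <= n)%N -> rho n <= rho' n) ->
    forall n : nat, (l <= n)%N -> rho' n = rho n.

Definition non_attainable (R : realType) (p : R) (l : nat) (rho : nat -> R) :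
    Prop :=
  forall u : int -> R[i], Hseq l u ->
    birman_lhs p l u = birman_rhs p l rho u ->
    (birman_rhs p l rho u < +oo)%E ->
    forall n : int, u n = 0.

Definition optimal_near_infinity (R : realType) (p : R) (l : nat)
    (rho : nat -> R) : Prop :=
  forall (m : nat) (eps : R), (l <= m)%N -> 0 < eps ->
    exists u : int -> R[i], H0seq m u /\
      (birman_lhs p l u < (1 + eps)%:E * birman_rhs p l rho u)%E.

Definition is_optimal_HRB_weight (R : realType) (p : R) (l : nat)
    (rho : nat -> R) : Prop :=
  [/\ is_HRB_weight p l rho, critical p l rho, non_attainable p l rho
    & optimal_near_infinity p l rho].

(* Meaningful when g_n and (- Delta_p^(l) g)_n are real with g_n > 0, in which
   case taking real parts loses nothing. *)
Definition rho_of (R : realType) (p : R) (l : nat) (g : int -> R[i]) :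
    nat -> R :=
  fun n => complex.Re (pLap p l g n%:Z) / complex.Re (g n%:Z) `^ (p - 1).

(* Main.v *)
Require Import Defs.
From HB Require Import structures.
From mathcomp Require Import all_boot all_order all_algebra.
From mathcomp Require Import complex.
From mathcomp Require Import all_classical all_reals all_analysis.
From mathcomp Require Import ring lra zify.
Import Order.TTheory GRing.Theory Num.Theory.
Import numFieldNormedType.Exports.
Local Open Scope classical_set_scope.
Local Open Scope ring_scope.
Local Open Scope complex_scope.

(** Shift the index so that everything starts at 0, and let [S] be the partial
sum operator, [F = nabla^l g > 0], [A = F^(p-1)] and [b = (-div)^l A], so that
[g = S^l F] and [rho = b / g^(p-1)].  All [(-div)^j A] are nonnegative, hence
repeated Abel summation gives [sum (S^l f) b <= sum f A] for [f >= 0].  Together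
with Jensen's inequality
[(S^l (F t))^p / g^(p-1) <= S^l (F t^p)] this is a Schur test proving the weight
inequality for [u = S^l (F t)].  Equality forces [t] to be constant, that is
[u = c g], which is excluded because [sum F^p] diverges: otherwise Hoelder's
inequality would give [g_n = o(n^(l - 1/p))], against the leading term of the
expansion.

As [F] is nonincreasing, [g_n = O(n^(l - 1/p))] implies [F_n = O(n^(-1/p))]; then
[A] tends to 0 and Abel summation is exact in the limit.  For every positive
sequence [c], the defect of Jensen's inequality at [n] is at most
[S^l (F Q(t, c_n))_n], with [Q] the defect of Young's inequality.  For
[t_i = i^(-e)] and [c_n = n^(-e)], [Q(t_i, c_n)] is of order
[e^2 log^2 (n / i)], so the total defect is [O(e^2) sum i^(-1 - p e) = O(e)], while
[sum (F t)^p] tends to infinity as [e] tends to 0.  Since [t] tends to 1, this gives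
criticality and optimality near infinity, once [S^l f] with [f] in [l^p] has been
approximated by finitely supported sequences: multiply it by
[binom(M - n, l) / binom(M, l)]. *)

(** * Partial sums and differences of sequences indexed from 0 *)

Definition psum {V : zmodType} (f : nat -> V) (n : nat) : V := \sum_(i < n.+1) f i.

(* [dif] is [- dive], which absorbs the sign [(-1) ^ l] of [pLap]. *)
Definition dif {V : zmodType} (a : nat -> V) (n : nat) : V := a n - a n.+1.

(* Backward difference under the convention [u (-1) = 0]. *)
Definition nab {V : zmodType} (u : nat -> V) (n : nat) : V :=
  if n is m.+1 then u n - u m else u 0%N.

Lemma psumS {V : zmodType} (f : nat -> V) n : psum f n.+1 = psum f n + f n.+1.
Proof. by rewrite /psum big_ord_recr. Qed.

Lemma psum0 {V : zmodType} (f : nat -> V) : psum f 0 = f 0%N.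
Proof. by rewrite /psum big_ord1. Qed.

Lemma nabK {V : zmodType} : cancel (@nab V) psum.
Proof.
move=> u; apply/funext => n; elim: n => [|n IHn]; first by rewrite psum0.
by rewrite psumS IHn /= addrC subrK.
Qed.

Lemma psumK {V : zmodType} : cancel (@psum V) nab.
Proof.
move=> f; apply/funext => -[|n] /=; first by rewrite psum0.
by rewrite psumS addrC addKr.
Qed.

Lemma iter_nabK {V : zmodType} l : cancel (iter l (@nab V)) (iter l psum).
Proof. by elim: l => [//|l IHl] u; rewrite iterSr [iter _ nab _]iterS nabK IHl. Qed.

(** * Order properties of iterated sums and Abel summation *)

Section RealSequences.
Context {R : realType}.
Implicit Types (f g h a u : nat -> R) (N n m l : nat).

Lemma psum_le f h n : (forall i, (i <= n)%N -> f i <= h i) -> psum f n <= psum h n.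
Proof. by move=> fh; apply: ler_sum => i _; apply: fh; rewrite -ltnS. Qed.

Lemma iter_psum_le l f h n :
  (forall i, (i <= n)%N -> f i <= h i) -> iter l psum f n <= iter l psum h n.
Proof.
elim: l n => [|l IHl] n fh /=; first exact: fh.
by apply: psum_le => i ile; apply: IHl => j jle; apply/fh/(leq_trans jle).
Qed.

Lemma iter_psumD l f h n :
  iter l psum (fun i => f i + h i) n = iter l psum f n + iter l psum h n.
Proof.
elim: l n => [//|l IHl] n /=; rewrite /psum -big_split.
by apply: eq_bigr => i _; rewrite IHl.
Qed.

Lemma iter_psumZ l (c : R) f n :
  iter l psum (fun i => c * f i) n = c * iter l psum f n.
Proof.
elim: l n => [//|l IHl] n /=; rewrite /psum mulr_sumr.
by apply: eq_bigr => i _; rewrite IHl.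
Qed.

Lemma iter_psum0 l n : iter l psum (fun=> 0 : R) n = 0.
Proof. by have := iter_psumZ l 0 (fun=> 0) n; rewrite !mul0r. Qed.

Lemma iter_psum_ge0 l f n :
  (forall i, (i <= n)%N -> 0 <= f i) -> 0 <= iter l psum f n.
Proof. by move=> f0; rewrite -(iter_psum0 l n); exact: iter_psum_le. Qed.

Lemma psum_ge_term f n i : (forall j, 0 <= f j) -> (i <= n)%N -> f i <= psum f n.
Proof.
move=> f0 ile; rewrite /psum (bigD1 (Ordinal (ile : (i < n.+1)%N))) //=.
by rewrite lerDl sumr_ge0.
Qed.

Lemma iter_psum_ge_term l f n i :
  (0 < l)%N -> (forall j, 0 <= f j) -> (i <= n)%N -> f i <= iter l psum f n.
Proof.
case: l => // l _ f0 ile; rewrite iterSr.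
elim: l => [|l IHl]; first exact: psum_ge_term.
rewrite iterS (le_trans IHl)// psum_ge_term// => j.
by apply: iter_psum_ge0 => k _; apply: (iter_psum_ge0 1).
Qed.

Lemma psum_nondec f : (forall j, 0 <= f j) -> {homo psum f : m n / (m <= n)%N >-> m <= n}.
Proof.
move=> f0 m n /subnK <-; elim: (n - m)%N => [|k IHk]; first by rewrite add0n.
by rewrite addSn psumS (le_trans IHk)// lerDl.
Qed.

(** Partial sums of a nonnegative sequence are nondecreasing, so each further summation costs at
    most a factor [n + 1]. *)
Lemma iter_psum_le_psum l f n : (forall j, 0 <= f j) ->
  iter l.+1 psum f n <= n.+1%:R ^+ l * psum f n.
Proof.
move=> f0; elim: l n => [|l IHl] n; first by rewrite expr0 mul1r.
rewrite iterS.
have : psum (iter l.+1 psum f) n <= psum (fun=> n.+1%:R ^+ l * psum f n) n.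
  apply: psum_le => i ile; apply: le_trans (IHl i) _; apply: ler_pM.
  - by rewrite exprn_ge0.
  - exact: (iter_psum_ge0 1).
  - by rewrite lerXn2r ?nnegrE// ler_nat.
  - exact: psum_nondec.
by move=> /le_trans; apply; rewrite /psum sumr_const card_ord -[leLHS]mulr_natl exprS mulrA.
Qed.

Lemma abel_psum f a N :
  \sum_(i < N) psum f i * dif a i = \sum_(i < N) f i * a i - (\sum_(i < N) f i) * a N.
Proof.
elim: N => [|N IHN]; first by rewrite !big_ord0 mul0r subr0.
rewrite !big_ord_recr /= IHN /psum /dif big_ord_recr /=; ring.
Qed.

(** Each Abel summation leaves a boundary term, the product of an iterated sum of [f] and a lower
    difference of [a]; the sign hypotheses allow it to be dropped. *)
Lemma abel_iter_le l f a N : (forall i, 0 <= f i) ->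
  (forall j n, (j < l)%N -> 0 <= iter j dif a n) ->
  \sum_(i < N) iter l psum f i * iter l dif a i <= \sum_(i < N) f i * a i.
Proof.
move=> f0; elim: l => [//|l IHl] a0.
apply: le_trans (IHl _); last by move=> j n jl; apply: a0; rewrite ltnW.
rewrite !iterS abel_psum gerBl mulr_ge0 ?a0//.
by apply: sumr_ge0 => i _; apply: iter_psum_ge0.
Qed.

Lemma abel_bound f a (B : R) : (forall i, 0 <= f i) -> (forall n, 0 <= dif a n) ->
  a @ \oo --> 0 ->
  (forall N, \sum_(i < N) psum f i * dif a i <= B) ->
  forall N, \sum_(i < N) f i * a i <= B.
Proof.
move=> f0 da0 acvg hB N.
have anon m n : (m <= n)%N -> a n <= a m.
  move=> /subnK <-; elim: (n - m)%N => [//|k IHk].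
  by rewrite addSn; apply: le_trans IHk; rewrite -subr_ge0; exact: da0.
have key k : \sum_(i < N) f i * a i - (\sum_(i < N) f i) * a (N + k)%N <= B.
  apply: le_trans (hB (N + k)%N); rewrite abel_psum.
  rewrite !mulr_suml -!sumrB big_split_ord /=.
  rewrite lerDl sumr_ge0// => i _; rewrite -mulrBr mulr_ge0// subr_ge0 anon//.
  by rewrite leq_add2l ltnW.
have lim : (\sum_(i < N) f i * a i - (\sum_(i < N) f i) * a (N + k)%N) @[k --> \oo] -->
           \sum_(i < N) f i * a i - (\sum_(i < N) f i) * 0.
  apply: cvgB; first exact: cvg_cst.
  apply: cvgMr; under eq_fun do rewrite addnC.
  by move: acvg; rewrite -(cvg_shiftn N).
rewrite mulr0 subr0 in lim.
by apply: (cvgr_to_le lim); apply: nearW.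
Qed.
End RealSequences.

(** * Young's inequality and estimates for real powers *)

Section RealPowers.
Context {R : realType}.
Implicit Types (p x y a b r s t : R).

Lemma powR_add x r s : 0 < x -> x `^ (r + s) = x `^ r * x `^ s.
Proof. by move=> x0; rewrite powRD// (gt_eqF x0) implybT. Qed.

Lemma le_lnDx x : 0 < x -> 1 + ln x <= x.
Proof. by move=> x0; rewrite -[leRHS]lnK//; exact: expR_ge1Dx. Qed.

(* The defect in Young's inequality [a b^(p-1) <= a^p / p + (1 - 1/p) b^p], times [p]. *)
Definition young_gap p a b : R := a `^ p - p * (a * b `^ (p - 1)) + (p - 1) * b `^ p.

(** By homogeneity the case [a, b > 0] reduces to [p * r < r ^ p + p - 1] for [r = a / b]. This
    combines [1 + x < expR x] at [x = (p - 1) * ln r] and at [x = - ln r], with weights for which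
    the logarithms cancel. *)
Lemma young_gap_gt0 p a b : 1 < p -> 0 <= a -> 0 <= b -> a != b -> 0 < young_gap p a b.
Proof.
move=> p1; rewrite /young_gap !le_eqVlt => /predU1P[<-|a0] /predU1P[<-|b0] neq.
- by rewrite eqxx in neq.
- rewrite powR0; last lra.
  by rewrite mul0r mulr0 subr0 add0r mulr_gt0 ?powR_gt0 ?subr_gt0.
- by rewrite !powR0; [rewrite !mulr0 subr0 addr0 powR_gt0 | lra..].
have := powR_gt0 p b0; set B := b `^ p => B0.
set r := a / b; have r0 : 0 < r by rewrite divr_gt0.
have abr : a = r * b by rewrite /r mulfVK ?gt_eqF.
have lnr : ln r != 0.
  by rewrite ln_eq0//; apply: contra neq => /eqP r1; rewrite abr r1 mul1r.
have bB : b * b `^ (p - 1) = B by rewrite mulr_powRB1 ?ltW//; lra.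
rewrite abr powRM ?ltW// -/B -(mulrA r) bB.
have -> : r `^ p * B - p * (r * B) + (p - 1) * B = (r `^ p - p * r + (p - 1)) * B by ring.
rewrite pmulr_lgt0//.
have rp : r `^ p = r * expR ((p - 1) * ln r).
  by rewrite -(mulr_powRB1 (ltW r0)) /powR ?gt_eqF//; lra.
have e1 : 1 + (p - 1) * ln r < expR ((p - 1) * ln r).
  by apply: expR_gt1Dx; rewrite mulf_neq0// subr_eq0 gt_eqF.
have e2 : 1 + - ln r < expR (- ln r) by apply: expR_gt1Dx; rewrite oppr_eq0.
have er : r * expR (- ln r) = 1 by rewrite expRN lnK// divff ?gt_eqF.
have : r * (1 + (p - 1) * ln r) + (p - 1) * (r * (1 - ln r)) <
   r * expR ((p - 1) * ln r) + (p - 1) * (r * expR (- ln r)).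
  by apply: ltrD; rewrite ltr_pM2l// ?ltr_pM2l// subr_gt0.
rewrite er rp; set E := r * expR _; set L := ln r; clearbody E L r => H.
lra.
Qed.

Lemma young_gap_ge0 p a b : 1 < p -> 0 <= a -> 0 <= b -> 0 <= young_gap p a b.
Proof.
move=> p1 a0 b0; have [->|neq] := eqVneq a b; last exact/ltW/young_gap_gt0.
rewrite /young_gap mulr_powRB1//; last lra.
by rewrite (_ : _ - _ + _ = 0)//; ring.
Qed.

Lemma young_gapZ p t a b : 0 < p -> 0 <= t -> 0 <= a -> 0 <= b ->
  young_gap p (t * a) (t * b) = t `^ p * young_gap p a b.
Proof.
move=> p0 t0 a0 b0; rewrite /young_gap !powRM//.
rewrite -(mulr_powRB1 t0 p0); ring.
Qed.

(** Adding the nonnegative gap with exchanged arguments produces [p * (1 - x) * (1 - x ^ (p - 1))],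
    and [1 + ln y <= y] bounds each factor by a multiple of [- ln x]. *)
Lemma young_gap1_le p x : 1 < p -> 0 < x <= 1 ->
  young_gap p 1 x <= p * (p - 1) * (ln x) ^+ 2.
Proof.
move=> p1 /andP[x0 x1].
have := young_gap_ge0 _ x 1 p1 (ltW x0) ler01.
rewrite /young_gap !powR1 mulr1 mul1r mulr1.
have xp : x * x `^ (p - 1) = x `^ p by rewrite mulr_powRB1 ?ltW//; lra.
have xp1 : x `^ (p - 1) <= 1 by rewrite -[leRHS](powRr0 x) ger_powR ?x0//; lra.
have l1 := le_lnDx _ x0.
have l2 := le_lnDx _ (powR_gt0 (p - 1) x0).
rewrite ln_powR in l2.
have lx := ln_le0 x1.
rewrite -xp; set y := x `^ (p - 1) in l2 xp1 *; set L := ln x in l1 l2 lx *.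
clearbody y L => H.
have : (1 - x) * (1 - y) <= - L * (- ((p - 1) * L)).
  apply: ler_pM; lra.
move=> H2.
have H3 : p * ((1 - x) * (1 - y)) <= p * (- L * (- ((p - 1) * L))).
  by rewrite ler_pM2l//; lra.
have -> : p * (p - 1) * L ^+ 2 = p * (- L * (- ((p - 1) * L))) by ring.
apply: le_trans H3; lra.
Qed.

Lemma ln_le_powR b x : 0 < b -> 0 < x -> ln x <= x `^ b / b.
Proof.
move=> b0 x0; rewrite ler_pdivlMr// mulrC -ln_powR.
by apply/ltW/ln_sublinear/powR_gt0.
Qed.

(** Taking out [x ^ (- e)] leaves the gap between 1 and [z ^ (- e)] with [z = y / x], which is of
    order [(e * ln z) ^ 2]; the logarithm is absorbed by a power of [z]. The factor [e ^ 2] is what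
    later makes the total defect small. *)
Lemma young_gap_pow p e d x y : 1 < p -> 0 < e -> 0 < d -> p * e <= d / 2 ->
  0 < x -> x <= y ->
  young_gap p (x `^ (- e)) (y `^ (- e)) <=
    p * (p - 1) * (4 / d) ^+ 2 * e ^+ 2 * x `^ (- d) * y `^ (d - p * e).
Proof.
move=> p1 e0 d0 ped x0 xy.
have y0 : 0 < y by apply: lt_le_trans xy.
set z := y / x; have z1 : 1 <= z by rewrite ler_pdivlMr// mul1r.
have z0 : 0 < z by apply: lt_le_trans z1.
have yz : y = x * z by rewrite /z mulrC mulfVK ?gt_eqF.
rewrite yz powRM ?(ltW x0) ?(ltW z0)// -[X in young_gap _ X _]mulr1.
rewrite young_gapZ ?powR_ge0//; last lra.
have z'1 : 0 < z `^ (- e) <= 1.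
  by rewrite powR_gt0//= -[leRHS](powRr0 z) ler_powR//; lra.
have g1 := young_gap1_le _ _ p1 z'1.
rewrite ln_powR in g1.
have L0 : 0 <= ln z by rewrite ln_ge0.
(* The square of [ln z <= (4 / d) * z ^ (d / 4)] has exponent [d / 2], which is at most
   [d - p * e]. *)
have d4 : 0 < d / 4 by lra.
have lz := ln_le_powR _ _ d4 z0.
have lz2 : (ln z) ^+ 2 <= (4 / d) ^+ 2 * z `^ (d - p * e).
  have : (ln z) ^+ 2 <= (z `^ (d / 4) / (d / 4)) ^+ 2.
    by rewrite lerXn2r ?nnegrE// divr_ge0 ?powR_ge0// ltW.
  move=> /le_trans; apply; rewrite invf_div exprMn mulrC ler_pM2l; last first.
    by rewrite exprn_gt0// divr_gt0.
  by rewrite -powR_mulrn ?powR_ge0// -powRrM ler_powR//; lra.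
have -> : (x `^ (- e)) `^ p = x `^ (- d) * x `^ (d - p * e).
  by rewrite -powRrM -powR_add//; congr (_ `^ _); ring.
rewrite powRM ?(ltW x0) ?(ltW z0)//.
set X := x `^ (- d) * x `^ (d - p * e).
have X0 : 0 <= X by rewrite mulr_ge0 ?powR_ge0.
have -> : p * (p - 1) * (4 / d) ^+ 2 * e ^+ 2 * x `^ (- d) *
  (x `^ (d - p * e) * z `^ (d - p * e)) =
  X * (p * (p - 1) * e ^+ 2 * ((4 / d) ^+ 2 * z `^ (d - p * e))) by rewrite /X; ring.
apply: ler_wpM2l => //; apply: le_trans g1 _.
have -> : p * (p - 1) * (- e * ln z) ^+ 2 = p * (p - 1) * e ^+ 2 * (ln z) ^+ 2 by ring.
by rewrite ler_wpM2l// !mulr_ge0 ?exprn_ge0//; lra.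
Qed.

(** Young's inequality with exponents [1 / r] and [1 / (1 - r)] gives
    [i ^ r * (i + 1) ^ (1 - r) <= i + 1 - r]; it remains to divide by [(i + 1) ^ (1 - r)]. *)
Lemma powR_diff_ge r (i : nat) : 0 < r < 1 ->
  r * i.+1%:R `^ (r - 1) <= i.+1%:R `^ r - (i%:R `^ r : R).
Proof.
move=> /andP[r0 r1].
have c0 : 0 < i.+1%:R :> R by rewrite ltr0n.
have := @conjugate_powR R (i%:R `^ r) (i.+1%:R `^ (1 - r)) r^-1 (1 - r)^-1
  (powR_ge0 _ _) (powR_ge0 _ _).
rewrite !invr_gt0 !invrK subr_gt0 => /(_ r0 r1).
rewrite (addrC r) subrK => /(_ erefl).
rewrite -!powRrM !divff ?gt_eqF ?subr_gt0// !powRr1 ?ler0n// => H.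
have {}H : i%:R `^ r * i.+1%:R `^ (1 - r) <= i.+1%:R - r.
  by apply: le_trans H _; rewrite -natr1; lra.
have := @powR_gt0 R _ (r - 1) c0 => P0.
have := ler_wpM2r (ltW P0) H.
rewrite -mulrA -powR_add// (_ : 1 - r + (r - 1) = 0); last ring.
rewrite powRr0 mulr1 mulrBl mulr_powRB1 ?(ltW c0)//; lra.
Qed.

Lemma psum_powR_le s n : 0 < s < 1 ->
  psum (fun i => i.+1%:R `^ (- s)) n <= n.+1%:R `^ (1 - s) / (1 - s).
Proof.
move=> /andP[s0 s1].
have s'0 : 0 < 1 - s by lra.
have step i : i.+1%:R `^ (- s) <= (i.+1%:R `^ (1 - s) - i%:R `^ (1 - s)) / (1 - s).
  rewrite ler_pdivlMr// mulrC; have := powR_diff_ge (1 - s) i.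
  by rewrite (_ : 1 - s - 1 = - s); [apply; lra | ring].
elim: n => [|n IHn]; last by rewrite psumS; have := step n.+1; lra.
by rewrite psum0; have := step 0%N; rewrite powR0 ?subr0//; lra.
Qed.

(** The terms after the first telescope against differences of [x ^ (- t) / t], by the
    Bernoulli-type bound [(1 - 1 / c) ^ (- t) >= 1 + t / c]. *)
Lemma sum_powR_le t (N : nat) : 0 < t ->
  \sum_(i < N) i.+1%:R `^ (- 1 - t) <= 1 + t^-1.
Proof.
move=> t0.
have step (i : nat) : i.+2%:R `^ (- 1 - t) <= (i.+1%:R `^ (- t) - i.+2%:R `^ (- t)) / t.
  rewrite ler_pdivlMr//.
  have k0 : 0 < i.+1%:R :> R by [].
  have c0 : 0 < i.+2%:R :> R by [].
  set k : R := i.+1%:R in k0 *; set c : R := i.+2%:R in c0 *.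
  have kc : k = c - 1 by rewrite /k /c -(natr1 i.+1) addrK.
  have kr : k = c * (k / c) by rewrite mulrC mulfVK ?gt_eqF.
  have r0 : 0 < k / c by rewrite divr_gt0.
  have l1 := le_lnDx _ r0.
  have e1 : 1 + (- t) * ln (k / c) <= (k / c) `^ (- t).
    by rewrite /powR gt_eqF// expR_ge1Dx.
  have kc1 : k / c = 1 - c^-1 by rewrite kc mulrBl divff ?gt_eqF ?mul1r.
  have e2 : 1 + t * c^-1 <= (k / c) `^ (- t).
    apply: le_trans e1; rewrite lerD2l mulNr -mulrN ler_pM2l//.
    move: l1; set L := ln _; rewrite kc1; clearbody L.
    by move: (c^-1) => w ?; lra.
  have e3 := ler_wpM2l (powR_ge0 c (- t)) e2.
  rewrite -powRM ?(ltW r0) ?(ltW c0)// -kr in e3.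
  have -> : c `^ (- 1 - t) = c^-1 * c `^ (- t).
    by rewrite powR_add// powR_inv1// ltW.
  by move: e3; move: (c^-1) (c `^ _) (k `^ _) => w x y ?; lra.
case: N => [|N]; first by rewrite big_ord0 addr_ge0// invr_ge0 ltW.
rewrite big_ord_recl /= powR1 lerD2l.
have : \sum_(i < N) (bump 0 i).+1%:R `^ (- 1 - t) <=
   (1 - N.+1%:R `^ (- t)) / t.
  elim: N => [|N IHN]; first by rewrite big_ord0 powR1 subrr mul0r.
  rewrite big_ord_recr /=; have := step N; move: IHN.
  rewrite /bump leq0n add1n; lra.
move=> /le_trans; apply; rewrite -[leRHS]mul1r ler_pM2r ?invr_gt0//.
Qed.
End RealPowers.

(** * Abel summation in the limit, and growth of the sums of an [l^p] sequence *)

Section IteratedSums.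
Context {R : realType}.
Implicit Types (f g h a u : nat -> R) (N n m l : nat).

Lemma iter_dif_cvg0 l a : a @ \oo --> 0 -> iter l dif a @ \oo --> 0.
Proof.
move=> a0; elim: l => [//|l IHl]; rewrite iterS -(subr0 (0 : R)).
by apply: cvgB => //; move: IHl; rewrite -cvg_shiftS.
Qed.

(** Partial converse of [abel_iter_le]: all differences of [a] tend to 0 along with [a], so no
    boundary term survives at any stage. *)
Lemma abel_iter_bound l f a (B : R) : (forall i, 0 <= f i) ->
  (forall j n, (0 < j <= l)%N -> 0 <= iter j dif a n) -> a @ \oo --> 0 ->
  (forall N, \sum_(i < N) iter l psum f i * iter l dif a i <= B) ->
  forall N, \sum_(i < N) f i * a i <= B.
Proof.
move=> f0; elim: l => [//|l IHl] da0 acvg hB; apply: IHl => //.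
  by move=> j n /andP[j0 jl]; rewrite da0// j0 ltnW.
apply: abel_bound => [i|n||N]; last by rewrite -!iterS.
- exact: iter_psum_ge0.
- by rewrite -iterS da0/=.
- exact: iter_dif_cvg0.
Qed.

Lemma powR_nat_unbounded (q K : R) : 0 < q -> \forall n \near \oo, K <= n.+1%:R `^ q.
Proof.
move=> q0; near=> n.
apply: le_trans (ler_norm K) _.
have -> : `|K| = (`|K| `^ q^-1) `^ q by rewrite -powRrM mulVf ?gt_eqF// powRr1.
apply: ge0_ler_powR; rewrite ?nnegrE ?powR_ge0 ?ler0n// ?(ltW q0)//.
apply: (@le_trans _ _ n%:R); last by rewrite ler_nat.
by near: n; exact: nbhs_infty_ger.
Unshelve. all: by end_near. Qed.

(** For [x > c] the factor [(x / c) ^ (p - 1)] is at least 1. Summed over an interval with a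
    suitable [c], this takes the place of Hoelder's inequality. *)
Lemma le_add_powR (p c x : R) : 1 < p -> 0 < c -> 0 <= x -> x <= c + c `^ (1 - p) * x `^ p.
Proof.
move=> p1 c0 x0; have [xc|cx] := leP x c.
  by rewrite (le_trans xc)// lerDl mulr_ge0 ?powR_ge0.
apply: (@le_trans _ _ (c `^ (1 - p) * x `^ p)); last by rewrite lerDr ltW.
have p0 : 0 < p by lra.
rewrite -(mulr_powRB1 x0 p0) mulrCA ler_peMr// -opprB powRN.
rewrite mulrC ler_pdivlMr ?powR_gt0// mul1r.
by apply: ge0_ler_powR; rewrite ?nnegrE ?(ltW c0) ?(ltW cx)//; lra.
Qed.

(* [c] in [le_add_powR] is [eta / 3 * (n + 1)^(-1/p)], past the index where
   the tail of [sum f^p] drops below [(eta / 3)^p]. *)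
Lemma psum_littleo p f (B eta : R) : 1 < p -> (forall i, 0 <= f i) ->
  (forall N, \sum_(i < N) f i `^ p <= B) -> 0 < eta ->
  \forall n \near \oo, psum f n <= eta * n.+1%:R `^ (1 - p^-1).
Proof.
move=> p1 f0 fB eta0.
pose s N := \sum_(i < N) f i `^ p.
have snd : nondecreasing_seq s.
  by apply/nondecreasing_seqP => n; rewrite /s big_ord_recr /= lerDl powR_ge0.
have scv : cvgn s.
  by apply: nondecreasing_is_cvgn => //; exists B => _ [n _ <-]; exact: fB.
pose e := eta / 3; have e0 : 0 < e by rewrite /e; lra.
have ep0 : 0 < e `^ p by apply: powR_gt0.
have /cvgrPdist_lt /(_ _ ep0) [N _ /(_ N (leqnn N)) /= HN] := scv.
have tail n : s n - s N <= e `^ p.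
  apply: le_trans (ltW HN); apply: le_trans (ler_norm _).
  by rewrite lerD2r nondecreasing_cvgn_le.
have q0 : 0 < 1 - p^-1 by rewrite subr_gt0 invf_lt1//; lra.
near=> n.
have Nn : (N <= n.+1)%N by apply: leqW; near: n; exact: nbhs_infty_ge.
have bigK : \sum_(i < N) f i <= e * n.+1%:R `^ (1 - p^-1).
  rewrite -ler_pdivrMl//; near: n; exact: powR_nat_unbounded.
have n0 : 0 < n.+1%:R :> R by [].
pose c := e * n.+1%:R `^ (- p^-1).
have c0 : 0 < c by rewrite mulr_gt0 ?powR_gt0.
have -> : psum f n = \sum_(i < N) f i + \sum_(N <= i < n.+1) f i.
  by rewrite /psum -!(big_mkord xpredT f) -big_cat_nat.
have T : \sum_(N <= i < n.+1) f i `^ p <= e `^ p.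
  apply: le_trans (tail n.+1); rewrite /s -!(big_mkord xpredT (fun i => f i `^ p)).
  by rewrite (big_cat_nat (m := 0%N) (n := N))//= addrAC subrr add0r.
have : \sum_(N <= i < n.+1) f i <=
    \sum_(N <= i < n.+1) (c + c `^ (1 - p) * f i `^ p).
  by apply: ler_sum => i _; exact: le_add_powR.
rewrite big_split /= sumr_const_nat -mulr_sumr => H.
have H1 : c *+ (n.+1 - N) <= e * n.+1%:R `^ (1 - p^-1).
  apply: (@le_trans _ _ (c *+ n.+1)); first by rewrite ler_wpMn2l ?leq_subr// ltW.
  by rewrite -[leLHS]mulr_natr /c powR_add// powRr1// -mulrA (mulrC _ n.+1%:R).
have H2 : c `^ (1 - p) * \sum_(N <= i < n.+1) f i `^ p <= e * n.+1%:R `^ (1 - p^-1).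
  apply: (@le_trans _ _ (c `^ (1 - p) * e `^ p)).
    by apply: ler_wpM2l => //; exact: powR_ge0.
  rewrite /c powRM ?powR_ge0 ?(ltW e0)// mulrAC -powR_add// -powRrM.
  rewrite (_ : 1 - p + p = 1); last ring.
  rewrite powRr1 ?(ltW e0)// (_ : - p^-1 * (1 - p) = 1 - p^-1)//.
  by field; lra.
(* One third each for the fixed head, for the at most [n + 1] copies of [c], and for the tail of the
   [p]-th powers. *)
have -> : eta = e + (e + e) by rewrite /e; field.
rewrite !mulrDl lerD//; apply: le_trans H _; exact: lerD.
Unshelve. all: by end_near. Qed.
End IteratedSums.

(** * Jensen's inequality for [S^l] with weights [F], and its defect *)

Section SchurTest.
Context {R : realType} (p : R) (l : nat) (F : nat -> R).
Hypotheses (p1 : 1 < p) (F0 : forall n, 0 < F n).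
Implicit Types (t : nat -> R) (N n m : nat).

Let p0 : 0 < p := lt_trans ltr01 p1.
Let G := iter l psum F.

Lemma iter_psum_gt0 n : 0 < G n.
Proof.
rewrite /G; elim: l n => [//|k IHk] n; rewrite iterS /psum big_ord_recl.
by apply: ltr_pwDl => //; apply: sumr_ge0 => i _; exact: ltW.
Qed.

Lemma iter_psum_young_gap t (c : R) n :
  iter l psum (fun i => F i * young_gap p (t i) c) n =
  iter l psum (fun i => F i * t i `^ p) n
  - p * c `^ (p - 1) * iter l psum (fun i => F i * t i) n + (p - 1) * c `^ p * G n.
Proof.
rewrite -mulNr -!iter_psumZ -!iter_psumD.
by congr (iter l psum _ n); apply/funext => i; rewrite /young_gap; ring.
Qed.

(** When [c] is the [F]-weighted mean of [t], the averaged Young defect is exactly the Jensen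
    defect. *)
Lemma iter_psum_jensen t n : (forall i, 0 <= t i) ->
  iter l psum (fun i => F i * young_gap p (t i) (iter l psum (fun i => F i * t i) n / G n)) n
  = iter l psum (fun i => F i * t i `^ p) n
    - G n * (iter l psum (fun i => F i * t i) n / G n) `^ p.
Proof.
move=> t0; rewrite iter_psum_young_gap.
set u := iter l psum (fun i => F i * t i) n.
have u0 : 0 <= u by apply: iter_psum_ge0 => i _; rewrite mulr_ge0// ltW.
have G0 := iter_psum_gt0 n.
have c0 : 0 <= u / G n by rewrite divr_ge0// ltW.
have {2}-> : u = G n * (u / G n) by rewrite mulrC mulfVK// gt_eqF.
rewrite -(mulr_powRB1 c0 p0); ring.
Qed.

Lemma iter_psum_jensen_le t n : (forall i, 0 <= t i) ->
  G n * (iter l psum (fun i => F i * t i) n / G n) `^ p <=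
  iter l psum (fun i => F i * t i `^ p) n.
Proof.
move=> t0; rewrite -subr_ge0 -iter_psum_jensen//.
have u0 : 0 <= iter l psum (fun i => F i * t i) n.
  by apply: iter_psum_ge0 => i _; rewrite mulr_ge0// ltW.
apply: iter_psum_ge0 => i _; rewrite mulr_ge0 ?(ltW (F0 _))//.
by apply: young_gap_ge0 => //; rewrite divr_ge0// ltW// iter_psum_gt0.
Qed.

(** Replacing the mean by an arbitrary [c] increases the averaged Young defect by [G n] times the
    gap between the mean and [c]. Hence [c] may be chosen for convenience. *)
Lemma iter_psum_jensen_gap t (c : R) n : (forall i, 0 <= t i) -> 0 <= c ->
  iter l psum (fun i => F i * t i `^ p) n <=
  G n * (iter l psum (fun i => F i * t i) n / G n) `^ p
  + iter l psum (fun i => F i * young_gap p (t i) c) n.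
Proof.
move=> t0 c0; rewrite iter_psum_young_gap.
set u := iter l psum (fun i => F i * t i) n.
have u0 : 0 <= u by apply: iter_psum_ge0 => i _; rewrite mulr_ge0// ltW.
have G0 := iter_psum_gt0 n.
have uG0 : 0 <= u / G n by rewrite divr_ge0// ltW.
have := mulr_ge0 (ltW G0) (young_gap_ge0 _ _ _ p1 uG0 c0); rewrite /young_gap.
have : u = G n * (u / G n) by rewrite mulrC mulfVK// gt_eqF.
move: (u / G n) => r -> ; lra.
Qed.

(** For [l > 0] the iterated sum dominates each of its nonnegative terms, so a vanishing defect
    forces every Young gap up to [n] to vanish, and the gap is strict off the diagonal. *)
Lemma iter_psum_jensen_eq t n : (0 < l)%N -> (forall i, 0 <= t i) ->
  iter l psum (fun i => F i * t i `^ p) n <=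
  G n * (iter l psum (fun i => F i * t i) n / G n) `^ p ->
  forall i, (i <= n)%N -> t i = iter l psum (fun i => F i * t i) n / G n.
Proof.
move=> l0 t0; rewrite -subr_le0 -iter_psum_jensen// => gap0 i ile.
have u0 : 0 <= iter l psum (fun i => F i * t i) n.
  by apply: iter_psum_ge0 => j _; rewrite mulr_ge0// ltW.
have c0 : 0 <= iter l psum (fun i => F i * t i) n / G n.
  by rewrite divr_ge0// ltW// iter_psum_gt0.
apply/eqP; apply: contraT => neq.
have := le_trans (iter_psum_ge_term _ _ _ i l0 _ ile) gap0.
rewrite leNgt mulr_gt0 ?young_gap_gt0//; apply => j.
by rewrite mulr_ge0 ?(ltW (F0 _))// young_gap_ge0.
Qed.
End SchurTest.

(** * Iterated sums of constants and of powers *)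

Section MonomialSums.
Context {R : realType}.
Implicit Types (f : nat -> R) (k n : nat).

Lemma exprS_diff_le k (y : R) : 0 <= y -> (y + 1) ^+ k.+1 - y ^+ k.+1 <= k.+1%:R * (y + 1) ^+ k.
Proof.
move=> y0; elim: k => [|k IHk]; first by rewrite !expr1 expr0 mulr1; lra.
have -> : (y + 1) ^+ k.+2 - y ^+ k.+2 =
   (y + 1) ^+ k.+1 + y * ((y + 1) ^+ k.+1 - y ^+ k.+1) by rewrite !exprS; ring.
rewrite -natr1 mulrDl mul1r addrC lerD2r.
apply: le_trans (ler_wpM2l y0 IHk) _.
rewrite mulrCA ler_wpM2l// exprS ler_wpM2r ?exprn_ge0//; lra.
Qed.

(** The right-hand side is [binom(n + k, k)]; the bound follows by telescoping
    [(i + 1) ^ (k + 1) - i ^ (k + 1)]. *)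
Lemma iter_psum1_ge k n : n.+1%:R ^+ k / k`!%:R <= iter k psum (fun=> 1 : R) n.
Proof.
elim: k n => [|k IHk] n; first by rewrite expr0 fact0 invr1 mulr1.
have step (i : nat) : (i.+1%:R ^+ k.+1 - i%:R ^+ k.+1) / k.+1`!%:R <=
    iter k psum (fun=> 1 : R) i.
  apply: le_trans (IHk i).
  rewrite ler_pdivrMr ?ltr0n ?fact_gt0// mulrAC ler_pdivlMr ?ltr0n ?fact_gt0//.
  rewrite factS natrM mulrA ler_pM2r ?ltr0n ?fact_gt0// mulrC -natr1.
  exact: exprS_diff_le.
rewrite iterS; elim: n => [|n IHn].
  by rewrite psum0; have := step 0%N; rewrite expr0n subr0.
by rewrite psumS; have := step n.+1; rewrite mulrBl; lra.
Qed.

(** Read backwards, this turns an upper bound on the iterated sum of a nonincreasing sequence into a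
    pointwise bound. *)
Lemma iter_psum_noninc_ge f k n : 0 <= f n -> (forall i, (i <= n)%N -> f n <= f i) ->
  f n * (n.+1%:R ^+ k / k`!%:R) <= iter k psum f n.
Proof.
move=> f0 fn; apply: (@le_trans _ _ (f n * iter k psum (fun=> 1) n)).
  by rewrite ler_wpM2l// iter_psum1_ge.
by rewrite -iter_psumZ; apply: iter_psum_le => i ile; rewrite mulr1 fn.
Qed.

Lemma iter_psum_powR_le (s : R) l n : 0 < s < 1 -> (0 < l)%N ->
  iter l psum (fun i => i.+1%:R `^ (- s)) n <= n.+1%:R `^ (l%:R - s) / (1 - s).
Proof.
move=> s01; case: l => // l _.
apply: le_trans (iter_psum_le_psum _ _ _ _) _; first by move=> j; exact: powR_ge0.
apply: le_trans (ler_wpM2l _ (psum_powR_le s n s01)) _; first exact: exprn_ge0.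
rewrite mulrA -powR_mulrn// -powR_add// (_ : l%:R + (1 - s) = l.+1%:R - s)//.
by rewrite -natr1; ring.
Qed.
End MonomialSums.

(** * The Hardy inequality generated by [F], its equality case, and slowly decaying perturbations *)

Section CriticalProfile.
Context {R : realType} (p : R) (l : nat) (F : nat -> R).
Let G := iter l psum F.
Let A n := F n `^ (p - 1).
Let b := iter l dif A.
Let rho n := b n / G n `^ (p - 1).
Hypotheses (p1 : 1 < p) (l0 : (0 < l)%N) (F0 : forall n, 0 < F n).
Hypotheses (dA : forall j n, (0 < j <= l)%N -> 0 <= iter j dif A n).
Implicit Types (t f : nat -> R) (N n m : nat).

Let p0 : 0 < p := lt_trans ltr01 p1.
Let G0 n : 0 < G n := iter_psum_gt0 l F F0 n.

Let b0 n : 0 <= b n.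
Proof. by rewrite /b dA// l0 leqnn. Qed.

Let A0 n : 0 <= A n. Proof. exact: powR_ge0. Qed.

Let FA t n : 0 <= t n -> F n * t n `^ p * A n = (F n * t n) `^ p.
Proof.
move=> t0; rewrite powRM// ?(ltW (F0 _))// mulrAC; congr (_ * _).
by rewrite mulr_powRB1// ltW.
Qed.

Lemma weight_powR n (u : R) : 0 <= u -> rho n * u `^ p = b n * (G n * (u / G n) `^ p).
Proof.
move=> u0; rewrite /rho -mulrA; congr (_ * _).
have -> : u `^ p = (G n * (u / G n)) `^ p by rewrite mulrC mulfVK// gt_eqF.
rewrite powRM ?(ltW (G0 _)) ?divr_ge0// ?(ltW (G0 _))// mulrA; congr (_ * _).
rewrite -(mulr_powRB1 (ltW (G0 n)) p0) mulrCA mulVf ?mulr1//.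
by rewrite gt_eqF// powR_gt0.
Qed.

(** Abel summation bounds the sum of [b * S^l (F t^p)] by the energy. The Jensen defects are kept on
    the left because the equality case needs them. *)
Lemma schur_deficit t N : (forall i, 0 <= t i) ->
  \sum_(n < N) rho n * (iter l psum (fun i => F i * t i) n) `^ p
  + \sum_(n < N) b n * (iter l psum (fun i => F i * t i `^ p) n
        - G n * (iter l psum (fun i => F i * t i) n / G n) `^ p)
  <= \sum_(i < N) (F i * t i) `^ p.
Proof.
move=> t0.
have -> : \sum_(i < N) (F i * t i) `^ p = \sum_(i < N) F i * t i `^ p * A i.
  by apply: eq_bigr => i _; rewrite FA.
have f0 i : 0 <= F i * t i `^ p by rewrite mulr_ge0 ?powR_ge0// ltW.
have A'0 j n : (j < l)%N -> 0 <= iter j dif A n.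
  by case: j => [|j] jl; [exact: A0 | apply: dA; rewrite /= ltnW].
apply: le_trans (abel_iter_le l _ A N f0 A'0).
rewrite -big_split /= le_eqVlt; apply/orP; left; apply/eqP; apply: eq_bigr => n _.
rewrite weight_powR; last first.
  by apply: iter_psum_ge0 => i _; rewrite mulr_ge0// ltW.
by rewrite -mulrDr addrC subrK mulrC.
Qed.

Lemma schur_deficit_term t n : (forall i, 0 <= t i) ->
  0 <= b n * (iter l psum (fun i => F i * t i `^ p) n
        - G n * (iter l psum (fun i => F i * t i) n / G n) `^ p).
Proof. by move=> t0; rewrite mulr_ge0// subr_ge0 iter_psum_jensen_le. Qed.

Lemma hardy_partial f N : (forall i, 0 <= f i) ->
  \sum_(n < N) rho n * (iter l psum f n) `^ p <= \sum_(i < N) f i `^ p.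
Proof.
move=> f0; pose t i := f i / F i.
have t0 i : 0 <= t i by rewrite divr_ge0// ltW.
have fE : f = (fun i => F i * t i).
  by apply/funext => i; rewrite /t mulrC mulfVK// gt_eqF.
rewrite fE; apply: le_trans (schur_deficit t N t0); rewrite lerDl.
by apply: sumr_ge0 => n _; exact: schur_deficit_term.
Qed.

(** A positive Jensen defect at one index [m] would stay, multiplied by [b m > 0], in every partial
    sum beyond [m] and keep the weighted sums a fixed distance below [L]. So all defects vanish and
    [f / F] is constant. *)
Lemma hardy_equality f (L : R) : (forall i, 0 <= f i) -> (forall n, 0 < b n) ->
  (forall N, \sum_(i < N) f i `^ p <= L) ->
  (forall e, 0 < e -> exists N, L - e < \sum_(n < N) rho n * (iter l psum f n) `^ p) ->
  exists2 c, 0 <= c & forall i, f i = c * F i.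
Proof.
move=> f0 b1 fL Lrho; pose t i := f i / F i.
have t0 i : 0 <= t i by rewrite divr_ge0// ltW.
have fE : f = (fun i => F i * t i).
  by apply/funext => i; rewrite /t mulrC mulfVK// gt_eqF.
have def0 m : iter l psum (fun i => F i * t i `^ p) m
        <= G m * (iter l psum (fun i => F i * t i) m / G m) `^ p.
  rewrite -subr_le0 leNgt; apply/negP => Em.
  have /Lrho [N] := mulr_gt0 (b1 m) Em; rewrite fE => HN.
  have rmon : \sum_(n < N) rho n * (iter l psum (fun i => F i * t i) n) `^ p <=
      \sum_(n < N + m.+1) rho n * (iter l psum (fun i => F i * t i) n) `^ p.
    rewrite big_split_ord /= lerDl sumr_ge0// => i _.
    by rewrite mulr_ge0 ?powR_ge0// divr_ge0// powR_ge0.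
  have sE : \sum_(i < N + m.+1) (F i * t i) `^ p = \sum_(i < N + m.+1) f i `^ p.
    by apply: eq_bigr => i _; rewrite [in RHS]fE.
  have := schur_deficit t (N + m.+1) t0.
  rewrite sE leNgt => /negP; apply.
  apply: le_lt_trans (fL _) _.
  rewrite -ltrBlDr; apply: lt_le_trans _ rmon; apply: le_lt_trans _ HN.
  rewrite lerD2l lerN2.
  have mN : (m < N + m.+1)%N by rewrite addnS ltnS leq_addl.
  rewrite [leRHS](bigD1 (Ordinal mN)) //= lerDl sumr_ge0// => i _.
  exact: schur_deficit_term.
exists (t 0%N) => // i.
(* On the whole range from 0 to [i], [t] equals its mean at [i]; comparing the two ends gives
   [t i = t 0]. *)
have eqi := iter_psum_jensen_eq p l F p1 F0 t i l0 t0 (def0 i).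
by rewrite [in LHS]fE (eqi 0%N)// (eqi i)// mulrC.
Qed.

Hypothesis G_le : exists C, forall n, G n <= C * n.+1%:R `^ (l%:R - p^-1).

Lemma profile_noninc i n : (i <= n)%N -> F n <= F i.
Proof.
move=> /subnK <-; elim: (n - i)%N => [//|k IHk]; rewrite addSn.
apply: le_trans IHk; rewrite leNgt; apply/negP => lt.
have : 0 <= iter 1 dif A (k + i) by apply: dA; rewrite l0.
rewrite /= /dif subr_ge0 leNgt => /negP; apply.
by apply: gt0_ltr_powR; rewrite ?nnegrE ?(ltW (F0 _)) ?subr_gt0.
Qed.

(** [F] is nonincreasing, so [F n * (n + 1) ^ l / l!] is at most [G n]. *)
Lemma profile_le : exists2 C, 0 < C & forall n, F n <= C * n.+1%:R `^ (- p^-1).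
Proof.
have [C HC] := G_le; exists (`|C| * l`!%:R + 1) => [|n].
  by rewrite ltr_pwDr// mulr_ge0.
have n0 : 0 < n.+1%:R :> R by [].
have := iter_psum_noninc_ge F l n (ltW (F0 n)) (fun i => profile_noninc i n).
move=> /le_trans /(_ (HC n)); rewrite powR_add// powR_mulrn//.
rewrite mulrCA [leRHS]mulrCA ler_pM2l ?exprn_gt0// => H.
apply: (@le_trans _ _ (`|C| * l`!%:R * n.+1%:R `^ (- p^-1))); last first.
  by rewrite ler_wpM2r ?powR_ge0// lerDl.
rewrite ler_pdivrMr ?ltr0n ?fact_gt0// in H; apply: le_trans H _.
rewrite mulrAC ler_wpM2r ?ler0n// ler_wpM2r ?powR_ge0//; exact: ler_norm.
Qed.

Let q0 : 0 < 1 - p^-1.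
Proof. by rewrite subr_gt0 invf_lt1. Qed.

Lemma profile_pow_le : exists2 C, 0 < C & forall n, A n <= C * n.+1%:R `^ (- (1 - p^-1)).
Proof.
have [C C0 HC] := profile_le; exists (C `^ (p - 1)) => [|n]; first exact: powR_gt0.
rewrite (_ : - (1 - p^-1) = - p^-1 * (p - 1)); last by field; rewrite gt_eqF.
rewrite powRrM -powRM ?powR_ge0 ?(ltW C0)// ge0_ler_powR ?nnegrE ?(ltW (F0 _))//.
  by rewrite subr_ge0 ltW.
by rewrite mulr_ge0 ?powR_ge0 ?(ltW C0).
Qed.

Lemma profile_pow_cvg0 : A @ \oo --> 0.
Proof.
have [C C0 HC] := profile_pow_le.
apply/cvgrPdist_le => e e0; near=> n.
rewrite sub0r normrN ger0_norm//; apply: le_trans (HC n) _.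
rewrite powRN ler_pdivrMr ?powR_gt0// -ler_pdivrMl//.
by near: n; exact: powR_nat_unbounded.
Unshelve. all: by end_near. Qed.

Hypothesis G_ge : exists2 c, 0 < c & \forall n \near \oo, c * n.+1%:R `^ (l%:R - p^-1) <= G n.

(** With bounded energy, [psum_littleo] followed by [l - 1] further summations would eventually put
    [G] below half of its lower bound. *)
Lemma profile_energy_unbounded (B : R) : exists N, B < \sum_(i < N) F i `^ p.
Proof.
apply: contrapT => /forallNP H.
have FB N : \sum_(i < N) F i `^ p <= B by rewrite leNgt; apply/negP/H.
have [c c0 Hc] := G_ge.
have c2 : 0 < c / 2 by lra.
have Fs := psum_littleo p F B _ p1 (fun i => ltW (F0 i)) FB c2.
have : \forall n \near \oo, False.
  near=> n.
  have n0 : 0 < n.+1%:R :> R by [].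
  have Pn := @powR_gt0 R _ (l%:R - p^-1) n0.
  have H1 : c * n.+1%:R `^ (l%:R - p^-1) <= G n by near: n.
  have H2 : psum F n <= c / 2 * n.+1%:R `^ (1 - p^-1) by near: n.
  have : G n <= c / 2 * n.+1%:R `^ (l%:R - p^-1).
    rewrite /G -(prednK l0); apply: le_trans (iter_psum_le_psum _ _ _ _) _.
      by move=> j; exact: ltW.
    apply: le_trans (ler_wpM2l _ H2) _; first exact: exprn_ge0.
    rewrite mulrCA -powR_mulrn// -powR_add// ler_pM2l// le_eqVlt.
    apply/orP; left; apply/eqP; congr (_ `^ _).
    by rewrite -(natr1 l.-1); ring.
  move=> H3; have := le_trans H1 H3; rewrite ler_pM2r//; lra.
by move=> [N _ /(_ N (leqnn N))].
Unshelve. all: by end_near. Qed.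

(** Serves both as the multiplier [t_i] and as the comparison constant [c_n]. *)
Definition slow_decay (e : R) (n : nat) : R := n.+1%:R `^ (- e).

Lemma slow_decay_energy : exists2 C, 0 < C & forall e, 0 < e -> forall N,
  \sum_(i < N) (F i * slow_decay e i) `^ p <= C * (1 + (p * e)^-1).
Proof.
have [C C0 HC] := profile_le; exists (C `^ p) => [|e e0 N]; first exact: powR_gt0.
have pe0 : 0 < p * e by rewrite mulr_gt0.
apply: le_trans (ler_wpM2l (powR_ge0 _ _) (sum_powR_le _ N pe0)).
rewrite mulr_sumr; apply: ler_sum => i _.
have -> : C `^ p * i.+1%:R `^ (- 1 - p * e) = (C * i.+1%:R `^ (- p^-1) * slow_decay e i) `^ p.
  rewrite /slow_decay !powRM ?mulr_ge0 ?powR_ge0 ?(ltW C0)// -mulrA; congr (_ * _).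
  rewrite -!powRrM -powR_add//; congr (_ `^ _); field; exact: lt0r_neq0.
apply: ge0_ler_powR; rewrite ?nnegrE ?mulr_ge0 ?powR_ge0 ?(ltW (F0 _)) ?(ltW C0) ?(ltW p0)//.
by rewrite ler_wpM2r ?powR_ge0.
Qed.

(** Up to the factor [l!], the power is bounded by [S^l h] for the nonincreasing power [h] of
    exponent [- (1 / p + s)]. Abel summation moves the differences off [A], and the decay of [A]
    leaves the exponent [- 1 - s]. *)
Lemma weighted_powR_sum_le : exists2 C, 0 < C & forall s, 0 < s -> forall N,
  \sum_(n < N) b n * n.+1%:R `^ (l%:R - p^-1 - s) <= C * (1 + s^-1).
Proof.
have [C C0 HC] := profile_pow_le; exists (l`!%:R * C) => [|s s0 N].
  by rewrite mulr_gt0// ltr0n fact_gt0.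
pose h i : R := i.+1%:R `^ (- (p^-1 + s)).
have h0 i : 0 <= h i by exact: powR_ge0.
have hn n i : (i <= n)%N -> h n <= h i.
  move=> ile; rewrite /h !powRN lef_pV2 ?posrE ?powR_gt0//.
  apply: ge0_ler_powR; rewrite ?nnegrE ?ler0n ?ler_nat//.
  by rewrite addr_ge0 ?invr_ge0 ?(ltW p0) ?(ltW s0).
apply: (@le_trans _ _ (l`!%:R * \sum_(n < N) iter l psum h n * b n)).
  rewrite mulr_sumr; apply: ler_sum => n _.
  rewrite mulrA mulrC ler_wpM2r// mulrC -ler_pdivrMr ?ltr0n ?fact_gt0//.
  apply: le_trans (iter_psum_noninc_ge h l n (h0 n) (hn n)).
  rewrite mulrA ler_pM2r ?invr_gt0 ?ltr0n ?fact_gt0// /h -powR_mulrn// -powR_add//.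
  by rewrite (_ : - (p^-1 + s) + l%:R = l%:R - p^-1 - s)//; ring.
rewrite -mulrA ler_pM2l ?ltr0n ?fact_gt0//.
apply: (@le_trans _ _ (\sum_(i < N) h i * A i)).
  apply: abel_iter_le => // -[|j] n jl //=.
  by apply: (dA j.+1); rewrite /= ltnW.
apply: le_trans (ler_wpM2l (ltW C0) (sum_powR_le _ N s0)).
rewrite mulr_sumr; apply: ler_sum => i _.
apply: le_trans (ler_wpM2l (h0 i) (HC i)) _.
rewrite mulrCA /h -powR_add// (_ : - (p^-1 + s) - (1 - p^-1) = - 1 - s)//; ring.
Qed.

(** The Young gap times the decay of [F] is a power of [i] with exponent [- s > -1], whose iterated
    sum gives [e ^ 2 * (n + 1) ^ (l - 1 / p - p * e)] up to a constant. Summing against [b] costs a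
    factor of order [1 / e], so one power of [e] remains. *)
Lemma slow_decay_gap : exists2 K, 0 < K & forall e, 0 < e <= 1 ->
  p * e <= (1 - p^-1) / 4 -> forall N,
  \sum_(n < N) b n *
     iter l psum (fun i => F i * young_gap p (slow_decay e i) (slow_decay e n)) n
  <= K * e.
Proof.
have [C C0 HC] := profile_le; have [D D0 HD] := weighted_powR_sum_le.
(* Half of the available room: [p^-1 + d] stays below 1, and the hypothesis on [e] reads
   [p * e <= d / 2]. *)
pose d := (1 - p^-1) / 2.
have d0 : 0 < d by rewrite divr_gt0.
pose s := p^-1 + d.
have pV0 : 0 < p^-1 by rewrite invr_gt0.
have s01 : 0 < s < 1.
  by rewrite /s /d; move: (p^-1) pV0 q0 => w w0 w1; apply/andP; split; lra.
pose M := p * (p - 1) * (4 / d) ^+ 2 * C / (1 - s).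
have M0 : 0 < M.
  by move/andP: s01 => [s0 s1]; rewrite divr_gt0 ?subr_gt0// !mulr_gt0 ?invr_gt0 ?subr_gt0.
exists (M * D * (1 + p^-1)) => [|e /andP[e0 e1] pe N].
  by rewrite mulr_gt0 ?addr_gt0// mulr_gt0.
have ped : p * e <= d / 2 by apply: le_trans pe _; rewrite /d; lra.
have pe0 : 0 < p * e by rewrite mulr_gt0.
have cst0 : 0 < p * (p - 1) * (4 / d) ^+ 2 * e ^+ 2.
  by rewrite !mulr_gt0 ?invr_gt0 ?subr_gt0.
have gapn n : iter l psum (fun i => F i * young_gap p (slow_decay e i) (slow_decay e n)) n
    <= M * e ^+ 2 * n.+1%:R `^ (l%:R - p^-1 - p * e).
  pose k := p * (p - 1) * (4 / d) ^+ 2 * e ^+ 2 * n.+1%:R `^ (d - p * e) * C.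
  have k0 : 0 <= k.
    by rewrite mulr_ge0 ?(ltW C0)// mulr_ge0 ?powR_ge0// (ltW cst0).
  apply: (@le_trans _ _ (k * iter l psum (fun i => i.+1%:R `^ (- s)) n)).
    rewrite -iter_psumZ; apply: iter_psum_le => i ile.
    have i0 : 0 < i.+1%:R :> R by [].
    have iln : i.+1%:R <= n.+1%:R :> R by rewrite ler_nat.
    have g1 := young_gap_pow p e d _ _ p1 e0 d0 ped i0 iln.
    apply: le_trans (ler_wpM2l (ltW (F0 i)) g1) _.
    have -> : k * i.+1%:R `^ (- s) = C * i.+1%:R `^ (- p^-1) *
      (p * (p - 1) * (4 / d) ^+ 2 * e ^+ 2 * i.+1%:R `^ (- d) * n.+1%:R `^ (d - p * e)).
      by rewrite /k /s opprD (powR_add i.+1%:R)//; ring.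
    rewrite ler_wpM2r//.
    by rewrite mulr_ge0 ?powR_ge0// mulr_ge0 ?powR_ge0// (ltW cst0).
  apply: le_trans (ler_wpM2l k0 (iter_psum_powR_le s l n s01 l0)) _.
  have -> : n.+1%:R `^ (l%:R - p^-1 - p * e) =
     n.+1%:R `^ (l%:R - s) * n.+1%:R `^ (d - p * e) :> R.
    by rewrite -powR_add// /s; congr (_ `^ _); ring.
  rewrite /k /M le_eqVlt; apply/orP; left; apply/eqP; ring.
apply: (@le_trans _ _ (M * e ^+ 2 * \sum_(n < N) b n * n.+1%:R `^ (l%:R - p^-1 - p * e))).
  rewrite mulr_sumr; apply: ler_sum => n _; rewrite mulrCA.
  by rewrite ler_wpM2l.
apply: le_trans (ler_wpM2l _ (HD _ pe0 N)) _.
  by rewrite mulr_ge0 ?exprn_ge0 ?(ltW M0) ?(ltW e0).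
have -> : M * e ^+ 2 * (D * (1 + (p * e)^-1)) = M * D * (e ^+ 2 + e * p^-1).
  by field; rewrite !lt0r_neq0.
rewrite -[leRHS]mulrA ler_pM2l; last exact: mulr_gt0.
rewrite expr2 mulrDl mul1r (mulrC e p^-1) lerD2r; apply: ler_piMl => //; exact: ltW.
Qed.

(** The Hardy inequality reversed up to an error [K * e]: Abel summation loses nothing in the limit,
    and the Jensen defects are bounded by the Young gaps at [c_n = slow_decay e n]. *)
Lemma slow_decay_deficit : exists2 K, 0 < K & forall e, 0 < e <= 1 ->
  p * e <= (1 - p^-1) / 4 -> forall B,
  (forall N, \sum_(n < N) rho n * iter l psum (fun i => F i * slow_decay e i) n `^ p <= B) ->
  forall N, \sum_(i < N) (F i * slow_decay e i) `^ p <= B + K * e.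
Proof.
have [K K0 HK] := slow_decay_gap; exists K => // e e01 pe B HB N.
have t0 i : 0 <= slow_decay e i by exact: powR_ge0.
under eq_bigr do rewrite -FA//.
apply: (abel_iter_bound l (fun i => F i * slow_decay e i `^ p) A) => [i|j n jl||N'].
- by rewrite mulr_ge0 ?powR_ge0// ltW.
- exact: dA.
- exact: profile_pow_cvg0.
apply: le_trans (lerD (HB N') (HK e e01 pe N')); rewrite -big_split /=.
apply: ler_sum => n _; rewrite weight_powR; last first.
  by apply: iter_psum_ge0 => i _; rewrite mulr_ge0// ltW.
rewrite -mulrDr mulrC ler_wpM2l//.
exact: iter_psum_jensen_gap.
Qed.
End CriticalProfile.

(** * Binomial estimates and the cutoff by [binom(M - n, l) / binom(M, l)] *)

Lemma bin_le_expn M k : ('C(M, k) <= M ^ k)%N.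
Proof.
elim: k M => [|k IHk] M; first by rewrite bin0.
case: M => [|M]; first by rewrite bin0n.
apply: (@leq_trans (k.+1 * 'C(M.+1, k.+1))); first by rewrite leq_pmull.
rewrite -mul_bin_diag expnS leq_mul2l /=.
by apply: leq_trans (IHk M) _; case: (k) => // k'; rewrite leq_exp2r.
Qed.

(** For [2 * k <= M] each factor of the falling factorial is at least [M / 2]. *)
Lemma expn_le_bin M k : (2 * k <= M -> M ^ k <= 2 ^ k * k`! * 'C(M, k))%N.
Proof.
move=> kM; rewrite -mulnA (mulnC k`!) bin_ffact.
have H j : (j <= k -> M ^ j <= 2 ^ j * M ^_ j)%N.
  elim: j => [//|j IHj] jk; rewrite ffactnSr !expnSr.
  rewrite mulnACA leq_mul ?IHj 1?ltnW//; lia.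
exact: H.
Qed.

(** By Pascal's rule each of the [n] unit steps down from [M] loses at most [binom(M, k)]. *)
Lemma bin_sub_ge M n k : ('C(M, k.+1) <= 'C(M - n, k.+1) + n * 'C(M, k))%N.
Proof.
elim: n => [|n IHn]; first by rewrite subn0 mul0n addn0.
apply: leq_trans IHn _; rewrite mulSn addnA leq_add2r subnS.
case E : (M - n)%N => [|a] /=; first by rewrite leq_addr.
by rewrite binS leq_add2l leq_bin2l// ltnW// -E leq_subr.
Qed.

Lemma sum_leq_indicator N M : (\sum_(n < N) (n <= M)%N <= M.+1)%N.
Proof.
apply: (@leq_trans (minn N M.+1)); last exact: geq_minr.
elim: N => [|N IHN]; first by rewrite big_ord0.
rewrite big_ord_recr /=; apply: leq_trans (leq_add IHN (leqnn _)) _; lia.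
Qed.

Section Cutoff.
Context {R : realType}.
Implicit Types (f u v : nat -> R) (k l n M N r : nat).

(* Truncated subtraction alone would leave the value 1 at [k = 0], [n > M]. *)
Definition cutoff M k n : R := if (n <= M)%N then 'C(M - n, k)%:R else 0.

(** The product rule for [nab] evaluates one of the two factors at the preceding index. *)
Definition shift v n : R := if n is m.+1 then v m else 0.

Lemma cutoff_ge0 M k n : 0 <= cutoff M k n.
Proof. by rewrite /cutoff; case: ifP. Qed.

Lemma cutoff_le M k n : cutoff M k n <= (n <= M)%:R * 'C(M, k)%:R.
Proof.
rewrite /cutoff; case: ifP => _; last by rewrite mul0r.
by rewrite mul1r ler_nat leq_bin2l// leq_subr.
Qed.

Lemma psum_shift v : psum (shift v) = shift (psum v).
Proof.
apply/funext => -[|n]; first by rewrite psum0.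
by rewrite /psum big_ord_recl /= add0r.
Qed.

Lemma iter_psum_shift r v : iter r psum (shift v) = shift (iter r psum v).
Proof. by elim: r => [//|r IHr]; rewrite !iterS IHr psum_shift. Qed.

Lemma iter_nabB {V : zmodType} r (u v : nat -> V) n :
  iter r nab (fun i => u i - v i) n = iter r nab u n - iter r nab v n.
Proof.
elim: r n => [//|r IHr] n; rewrite !iterS.
by case: n => [|n] /=; rewrite !IHr// !opprD !opprK addrACA.
Qed.

Lemma iter_nabZ r (c : R) v n : iter r nab (fun i => c * v i) n = c * iter r nab v n.
Proof.
by elim: r n => [//|r IHr] [|n] /=; rewrite !IHr// mulrBr.
Qed.

(** Product rule; by Pascal's rule the backward difference of a cutoff of order [k + 1] is minus the
    cutoff of order [k]. *)
Lemma nab_cutoff M k v :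
  nab (fun n => cutoff M k.+1 n * v n) =
  (fun n => cutoff M k.+1 n * nab v n - cutoff M k n * shift v n).
Proof.
apply/funext => -[|n] /=; first by rewrite mulr0 subr0.
suff -> : cutoff M k.+1 n = cutoff M k.+1 n.+1 + cutoff M k n.+1 by ring.
rewrite /cutoff; case: ltngtP => [nM|Mn|<-].
- by rewrite -natrD -binS; congr ('C(_, _)%:R); lia.
- by rewrite addr0.
- by rewrite subnn addr0.
Qed.

(** Leibniz' rule by induction. The main term puts all differences on [S^r f]; the other [2 ^ r - 1]
    terms difference the cutoff at least once, and each is at most [M ^ (k - 1) * psum f M]. *)
Lemma iter_nab_cutoff M r k f n : (r <= k)%N -> (forall i, 0 <= f i) ->
  `|iter r nab (fun i => cutoff M k i * iter r psum f i) n| <=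
  cutoff M k n * f n + (n <= M)%:R * ((2 ^+ r - 1) * M%:R ^+ k.-1 * psum f M).
Proof.
elim: r k f n => [|r IHr] k f n rk f0.
  by rewrite /= subrr !mul0r mulr0 addr0 ger0_norm// mulr_ge0 ?cutoff_ge0.
case: k rk => // k rk; rewrite iterSr iterS nab_cutoff psumK iter_nabB.
have psf0 i : 0 <= psum f i by apply: (iter_psum_ge0 1).
have sh0 i : 0 <= shift (psum f) i by case: i => [|i]; rewrite /= ?psf0.
rewrite -iterS iterSr -iter_psum_shift.
apply: le_trans (ler_normB _ _) _.
have H1 := IHr k.+1 f n (leqW rk) f0.
have H2 := IHr k (shift (psum f)) n rk sh0.
apply: le_trans (lerD H1 H2) _; rewrite -addrA lerD2l {H1 H2 IHr}.
have two0 : 0 <= 2 ^+ r - 1 :> R by rewrite subr_ge0 exprn_ege1// ler1n.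
have shM i : (i <= M)%N -> shift (psum f) i <= psum f M.
  by case: i => [|i] iM //=; exact: psum_nondec f0 _ _ (ltnW iM).
have C1 : cutoff M k n * shift (psum f) n <= (n <= M)%:R * (M%:R ^+ k * psum f M).
  have [nM|nM] := leqP n M; last by rewrite /cutoff leqNgt nM !mul0r.
  rewrite mul1r; apply: ler_pM => //; first exact: cutoff_ge0; last exact: shM.
  apply: le_trans (cutoff_le M k n) _.
  by rewrite nM mul1r -natrX ler_nat bin_le_expn.
have C2 : (n <= M)%:R * ((2 ^+ r - 1) * M%:R ^+ k.-1 * psum (shift (psum f)) M) <=
          (n <= M)%:R * ((2 ^+ r - 1) * M%:R ^+ k * psum f M).
  rewrite ler_wpM2l ?ler0n//; case: r rk two0 => [|r] rk two0.
    by rewrite subrr !mul0r.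
  rewrite -!mulrA ler_wpM2l//; case: k rk {C1} => // k rk.
  rewrite /= exprSr -mulrA ler_wpM2l ?exprn_ge0//.
  (* The shift leaves only [M] terms in the outer sum, which costs exactly one factor [M]. *)
  rewrite /psum big_ord_recl /= add0r.
  have : \sum_(i < M) psum f i <= \sum_(i < M) psum f M.
    by apply: ler_sum => i _; apply: psum_nondec => //; exact: ltnW.
  by rewrite sumr_const card_ord -[leRHS]mulr_natl.
apply: le_trans (lerD _ (lerD C1 C2)) _; first exact: lexx.
rewrite /= exprSr; move: (2 ^+ r) (M%:R ^+ k) => x y.
by rewrite le_eqVlt; apply/orP; left; apply/eqP; ring.
Qed.

(** If [y <= la * x], then [x + y <= (1 + la) * x]; otherwise [x + y <= (1 + 1 / la) * y]. A small
    [la] keeps the coefficient of the main term near 1. *)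
Lemma powRD_le (p la x y : R) : 0 < p -> 0 < la -> 0 <= x -> 0 <= y ->
  (x + y) `^ p <= (1 + la) `^ p * x `^ p + (1 + la^-1) `^ p * y `^ p.
Proof.
move=> p0 la0 x0 y0.
have la10 : 0 <= 1 + la by rewrite addr_ge0// ltW.
have laV0 : 0 <= 1 + la^-1 by rewrite addr_ge0// invr_ge0 ltW.
rewrite -!powRM//; have [yx|xy] := leP y (la * x).
  apply: le_trans (_ : ((1 + la) * x) `^ p <= _); last by rewrite lerDl powR_ge0.
  apply: ge0_ler_powR; rewrite ?nnegrE ?addr_ge0 ?mulr_ge0 ?(ltW p0)//; lra.
apply: le_trans (_ : ((1 + la^-1) * y) `^ p <= _); last by rewrite lerDr powR_ge0.
apply: ge0_ler_powR; rewrite ?nnegrE ?addr_ge0 ?mulr_ge0 ?(ltW p0)//.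
rewrite mulrDl mul1r addrC lerD2l ler_pdivlMl//; exact: ltW.
Qed.

(** The Leibniz error [e] at each index is of order [psum f M / M], which is [o(M ^ (- 1 / p))] by
    [psum_littleo]; raised to the power [p] over [M + 1] indices, it is negligible. *)
Lemma cutoff_approx (p : R) l f (B eta : R) N0 : 1 < p -> (0 < l)%N ->
  (forall i, 0 <= f i) -> (forall N, \sum_(i < N) f i `^ p <= B) -> 0 < eta ->
  exists z : nat -> R,
    [/\ forall n, 0 <= z n <= 1,
        exists M, forall n, (M < n)%N -> z n = 0,
        forall n, (n < N0)%N -> 1 - eta <= z n &
        forall N, \sum_(n < N) `|iter l nab (fun i => z i * iter l psum f i) n| `^ p
          <= (1 + eta) * B + eta].
Proof.
move=> p1 l0 f0 fB eta0.
have p0 : 0 < p by lra.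
(* Chosen so that [(1 + la) ^ p = 1 + eta]. *)
pose la := (1 + eta) `^ p^-1 - 1.
have la0 : 0 < la.
  have pV0 : 0 < p^-1 by rewrite invr_gt0.
  have := @gt0_ltr_powR R _ pV0 1 (1 + eta); rewrite powR1 subr_gt0; apply.
  - by rewrite nnegrE.
  - by rewrite nnegrE addr_ge0// ltW.
  - by rewrite ltrDl.
have laE : (1 + la) `^ p = 1 + eta.
  by rewrite /la addrC subrK -powRrM mulVf ?gt_eqF// powRr1// addr_ge0// ltW.
pose K : R := 4 ^+ l * l`!%:R.
have K0 : 0 < K by rewrite mulr_gt0 ?exprn_gt0// ltr0n fact_gt0.
have laV0 : 0 < 1 + la^-1 by rewrite addr_gt0// invr_gt0.
(* Chosen so that the total error, at most [((1 + 1 / la) * 2 * K * eta') ^ p], equals [eta]. *)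
pose eta' := eta `^ p^-1 / ((1 + la^-1) * (2 * K)).
have eta'0 : 0 < eta' by rewrite divr_gt0 ?powR_gt0// !mulr_gt0.
have eta'E : (1 + la^-1) * (2 * K * eta') = eta `^ p^-1.
  by rewrite /eta'; field; rewrite !lt0r_neq0//= addr_gt0.
have KE : K = 4 ^+ l * l`!%:R by [].
clearbody eta' K.
have near_small := psum_littleo p f B eta' p1 f0 fB eta'0.
have : \forall M \near \oo, [/\ (2 * l <= M)%N, (0 < M)%N,
   (N0 <= M)%N, psum f M <= eta' * M.+1%:R `^ (1 - p^-1) & N0%:R * K / eta <= M%:R].
  near=> M; split; near: M.
  - exact: nbhs_infty_ge.
  - exact: nbhs_infty_gt.
  - exact: nbhs_infty_ge.
  - exact: near_small.
  - exact: nbhs_infty_ger.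
move=> [M _ /(_ M (leqnn M)) [lM M0 N0M psM MN0]].
have M'0 : 0 < M%:R :> R by rewrite ltr0n.
pose D : R := 'C(M, l)%:R.
have D0 : 0 < D by rewrite ltr0n bin_gt0 (leq_trans _ lM)// leq_pmull.
have DM : M%:R ^+ l.-1 / D <= 2 ^+ l * l`!%:R / M%:R.
  rewrite ler_pdivrMr// mulrAC ler_pdivlMr// -exprSr prednK//.
  by rewrite -!natrX -!natrM ler_nat expn_le_bin.
pose e := 2 ^+ l * M%:R ^+ l.-1 * psum f M / D.
have psM0 : 0 <= psum f M by apply: (iter_psum_ge0 1).
have e0 : 0 <= e by rewrite !mulr_ge0 ?exprn_ge0 ?invr_ge0 ?(ltW D0).
have eM : M.+1%:R * e `^ p <= (2 * K * eta') `^ p.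
  have eb : e <= 2 * K * eta' * M.+1%:R `^ (- p^-1).
    have -> : e = 2 ^+ l * psum f M * (M%:R ^+ l.-1 / D) by rewrite /e; ring.
    apply: (@le_trans _ _ (2 ^+ l * (eta' * M.+1%:R `^ (1 - p^-1)) * (2 ^+ l * l`!%:R / M%:R))).
      apply: ler_pM => //; rewrite ?mulr_ge0 ?exprn_ge0 ?invr_ge0 ?(ltW D0)//.
      by rewrite ler_wpM2l ?exprn_ge0.
    rewrite powR_add// powRr1//.
    have -> : 2 ^+ l * (eta' * (M.+1%:R * M.+1%:R `^ (- p^-1))) * (2 ^+ l * l`!%:R / M%:R) =
       (K * eta' * M.+1%:R `^ (- p^-1)) * (M.+1%:R / M%:R).
      by rewrite KE (_ : 4 = 2 * 2 :> R) ?exprMn; [ring | rewrite -natrM].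
    have -> : 2 * K * eta' * M.+1%:R `^ (- p^-1) = (K * eta' * M.+1%:R `^ (- p^-1)) * 2 by ring.
    rewrite ler_wpM2l ?mulr_ge0 ?powR_ge0 ?(ltW K0) ?(ltW eta'0)//.
    rewrite ler_pdivrMr// -natr1; have : 1 <= M%:R :> R by rewrite ler1n.
    by move: (M%:R) => x ?; lra.
  have := ge0_ler_powR (ltW p0) _ _ eb.
  rewrite !nnegrE => /(_ e0); rewrite !mulr_ge0 ?powR_ge0 ?(ltW K0) ?(ltW eta'0)//.
  move=> /(_ isT) H; have := ler_wpM2l (ler0n R M.+1) H; move=> /le_trans; apply.
  rewrite [X in _ * X]powRM ?mulr_ge0 ?powR_ge0 ?(ltW K0) ?(ltW eta'0)//.
  rewrite -powRrM mulNr mulVf ?gt_eqF// powR_inv1// mulrCA divff ?mulr1//.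
exists (fun n => cutoff M l n / D); split.
- move=> n; rewrite divr_ge0 ?cutoff_ge0 ?(ltW D0)//= ler_pdivrMr// mul1r.
  apply: le_trans (cutoff_le M l n) _; rewrite ler_piMl ?(ltW D0)//.
  by case: (_ <= _)%N.
- by exists M => n Mn; rewrite /cutoff leqNgt Mn mul0r.
(* Here [1 - z n] is at most [n * binom(M, l - 1) / binom(M, l)], hence at most [n * K / M], and [M]
   was taken large compared with [N0 * K / eta]. *)
- move=> n nN0.
  have nK : n%:R * K <= eta * M%:R.
    apply: (@le_trans _ _ (N0%:R * K)); first by rewrite ler_pM2r// ler_nat ltnW.
    by rewrite [leRHS]mulrC -ler_pdivrMr.
  have nM : (n <= M)%N by rewrite ltnW// (leq_trans nN0).
  rewrite /cutoff nM ler_pdivlMr// mulrBl mul1r lerBlDr.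
  have := bin_sub_ge M n l.-1; rewrite prednK// -(ler_nat R) natrD natrM.
  move=> /le_trans; apply; rewrite lerD2l.
  apply: (@le_trans _ _ (n%:R * M%:R ^+ l.-1)).
    by rewrite ler_wpM2l// -natrX ler_nat bin_le_expn.
  rewrite ler_pdivrMr// in DM; apply: le_trans (ler_wpM2l (ler0n R n) DM) _.
  rewrite mulrA ler_wpM2r ?(ltW D0)// mulrA ler_pdivrMr//.
  apply: le_trans nK; rewrite ler_wpM2l// KE ler_wpM2r//.
  by rewrite lerXn2r ?nnegrE// ler_nat.
have bnd n : `|iter l nab (fun i => cutoff M l i / D * iter l psum f i) n| `^ p <=
    (1 + eta) * f n `^ p + (n <= M)%:R * ((1 + la^-1) `^ p * e `^ p).
  have -> : (fun i => cutoff M l i / D * iter l psum f i) =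
            (fun i => D^-1 * (cutoff M l i * iter l psum f i)).
    by apply/funext => i; rewrite mulrCA mulrA.
  rewrite iter_nabZ normrM ger0_norm ?invr_ge0 ?(ltW D0)//.
  have := iter_nab_cutoff M l l f n (leqnn l) f0.
  set x := `|_|; have [nM|nM] := leqP n M => H; last first.
    have -> : x = 0.
      apply/eqP; rewrite eq_le normr_ge0 andbT; apply: le_trans H _.
      by rewrite /cutoff leqNgt nM !mul0r addr0.
    by rewrite mulr0 powR0 ?gt_eqF// mul0r addr0 mulr_ge0 ?powR_ge0// addr_ge0// ltW.
  rewrite mul1r -laE; apply: le_trans (powRD_le p la (f n) e p0 la0 (f0 n) e0).
  apply: ge0_ler_powR; rewrite ?nnegrE ?(ltW p0)//.
  - by rewrite mulr_ge0 ?invr_ge0 ?(ltW D0)// normr_ge0.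
  - by rewrite addr_ge0.
  rewrite mulrC ler_pdivrMr//; apply: le_trans H _; rewrite mul1r [leRHS]mulrDl lerD//.
    rewrite mulrC ler_wpM2l//; apply: le_trans (cutoff_le M l n) _.
    by rewrite nM mul1r.
  rewrite /e mulfVK ?gt_eqF// ler_wpM2r// ler_wpM2r ?exprn_ge0// gerBl//.
move=> N. apply: (@le_trans _ _ (\sum_(n < N) ((1 + eta) * f n `^ p +
    (n <= M)%:R * ((1 + la^-1) `^ p * e `^ p)))).
  by apply: ler_sum => n _; exact: bnd.
rewrite big_split /= -mulr_sumr -mulr_suml; apply: lerD.
  by apply: ler_wpM2l (fB N); rewrite addr_ge0// ltW.
have cnt : \sum_(n < N) (n <= M)%:R <= M.+1%:R :> R.
  by rewrite -natr_sum ler_nat sum_leq_indicator.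
apply: le_trans (ler_wpM2r _ cnt) _; first by rewrite mulr_ge0 ?powR_ge0.
rewrite mulrCA; apply: le_trans (ler_wpM2l (powR_ge0 _ _) eM) _.
rewrite -powRM ?(ltW laV0) ?mulr_ge0 ?(ltW K0) ?(ltW eta'0)//.
by rewrite eta'E -powRrM mulVf ?gt_eqF// powRr1// ltW.
Unshelve. all: by end_near. Qed.
End Cutoff.

(** * Extended-real series starting at [l] and their shifted partial sums *)

Section Series.
Context {R : realType}.
Implicit Types (h : nat -> R) (l n N : nat).

Lemma sum_nat_shift h l n : \sum_(l <= i < n) h i = \sum_(k < n - l) h (l + k)%N.
Proof.
by rewrite -{1}[l]add0n big_addn big_mkord; apply: eq_bigr => i _; rewrite addnC.
Qed.

Lemma nneseries_shift_le h l (x : \bar R) : (forall n, (l <= n)%N -> 0 <= h n) ->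
  (forall N, ((\sum_(k < N) h (l + k)%N)%:E <= x)%E) ->
  (\sum_(l <= n <oo) (h n)%:E <= x)%E.
Proof.
move=> h0 hx; apply: lime_le.
  by apply: is_cvg_nneseries => n ln _; rewrite lee_fin h0.
by apply: nearW => n; rewrite sumEFin sum_nat_shift.
Qed.

Lemma nneseries_shift_ge h l N : (forall n, (l <= n)%N -> 0 <= h n) ->
  ((\sum_(k < N) h (l + k)%N)%:E <= \sum_(l <= n <oo) (h n)%:E)%E.
Proof.
move=> h0; have := @nneseries_lim_ge R (fun n => (h n)%:E) xpredT l (l + N).
rewrite sumEFin sum_nat_shift addKn; apply => n ln _.
by rewrite lee_fin h0.
Qed.
End Series.

(** * Transfer between sequences on the integers and sequences indexed from 0 *)

Section Bridge.
Context {R : realType}.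
Implicit Types (u : int -> R[i]) (w : nat -> R) (l j k n m : nat).

Definition restrict l u k : R[i] := u (l + k)%N%:Z.

Definition extend l w (i : int) : R[i] :=
  if i is Posz n then (if (l <= n)%N then (w (n - l)%N)%:C else 0) else 0.

Lemma cmod_real (x : R) : cmod x%:C = `|x|.
Proof. by rewrite /= expr0n /= addr0 sqrtr_sqr. Qed.

Lemma cmod_ge0 (z : R[i]) : 0 <= cmod z.
Proof. by case: z => x y; exact: sqrtr_ge0. Qed.

Lemma cmodD (x y : R[i]) : cmod (x + y) <= cmod x + cmod y.
Proof. exact: (@le_normcD R x y). Qed.

Lemma cmodB (x y : R[i]) : cmod (x - y) <= cmod x + cmod y.
Proof. by apply: le_trans (cmodD _ _) _; rewrite (@normcN R y). Qed.

Lemma iter_nabla_real w k n :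
  iter k nab (fun i => (w i)%:C) n = (iter k nab w n)%:C.
Proof.
elim: k n => [//|k IHk] n; rewrite !iterS.
by case: n => [|n] /=; rewrite !IHk// rmorphB.
Qed.

Lemma Hseq_nabla l u : Hseq l u -> Hseq l (nabla u).
Proof. by move=> u0 n nl; rewrite /nabla !u0 ?subr0//; lia. Qed.

Lemma restrict_nabla l u : Hseq l u -> restrict l (nabla u) = nab (restrict l u).
Proof.
move=> u0; apply/funext => -[|k]; rewrite /restrict /nabla /=.
  by rewrite (u0 (_ - 1)) ?subr0//; lia.
by congr (_ - u _); lia.
Qed.

Lemma restrict_iter_nabla l u k : Hseq l u ->
  restrict l (iter k (@nabla R[i]) u) = iter k nab (restrict l u).
Proof.
elim: k u => [//|k IHk] u u0.
by rewrite !iterSr IHk ?restrict_nabla//; exact: Hseq_nabla.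
Qed.

Lemma restrict_extend l w k : restrict l (extend l w) k = (w k)%:C.
Proof. by rewrite /restrict /= leq_addr addKn. Qed.

Lemma cmod_iter_nabla_extend l w j k :
  cmod (iter j (@nabla R[i]) (extend l w) (l + k)%N%:Z) = `|iter j nab w k|.
Proof.
have e0 : Hseq l (extend l w) by case=> [n|n] //= nl; rewrite leqNgt (_ : n < l)%N//; lia.
rewrite -/(restrict l _ k) restrict_iter_nabla//.
rewrite (_ : restrict l _ = fun k => (w k)%:C).
  by rewrite iter_nabla_real cmod_real.
by apply/funext => i; rewrite restrict_extend.
Qed.

Lemma H0seq_extend l m w M : (l <= m)%N ->
  (forall k, (l + k < m)%N -> w k = 0) -> (forall k, (M < k)%N -> w k = 0) ->
  H0seq m (extend l w).
Proof.
move=> lm wm wM; split.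
  case=> [n|n] //= nm; case: ifP => // ln.
  by rewrite wm//; lia.
apply: (@sub_finite_set _ _ (Posz @` `I_(l + M).+1)); last first.
  by apply: finite_image; exact: finite_II.
case=> [n|n] /=; last by rewrite eqxx.
case: ifP => [ln|]; last by rewrite eqxx.
move=> nz; exists n => //=; rewrite ltnS leqNgt; apply/negP => lt.
by move/eqP: nz; apply; rewrite wM//; lia.
Qed.

(** On [H^l] the sequence is the [l]-fold sum of its [l]-th difference, so the triangle inequality
    applies at each summation. This reduces complex sequences to nonnegative ones. *)
Lemma cmod_le_iter_psum l u k : Hseq l u ->
  cmod (u (l + k)%N%:Z) <=
  iter l psum (fun i => cmod (iter l (@nabla R[i]) u (l + i)%N%:Z)) k.
Proof.
move=> u0; rewrite -/(restrict l u k).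
have -> : (fun i => cmod (iter l (@nabla R[i]) u (l + i)%N%:Z)) =
  (fun i => cmod (iter l nab (restrict l u) i)).
  by apply/funext => i; rewrite -restrict_iter_nabla.
move: (restrict l u) => {u0}v; elim: l k => [//|j IHj] k.
rewrite iterSr; apply: (@le_trans _ _ (iter j psum (fun i => cmod (iter j nab v i)) k)) => //.
apply: iter_psum_le => i _; rewrite iterS.
move: (iter j nab v) => x; elim: i => [|i IHi]; first by rewrite psum0.
rewrite psumS; apply: (@le_trans _ _ (cmod (x i) + cmod (nab x i.+1))).
  by apply: le_trans (cmodD _ _); rewrite /= addrC subrK.
by rewrite lerD2r.
Qed.

Lemma signed_pow_real (a x : R) : 0 < a -> 0 <= x -> signed_pow a x%:C = (x `^ a)%:C.
Proof.
by move=> a0 x0; rewrite /signed_pow cmod_real ger0_norm// -rmorphM /= mulr_powRB1.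
Qed.

Lemma dive_iter_real (v : int -> R[i]) (a : nat -> R) l m k :
  (forall n, v (l + n)%N%:Z = (a n)%:C) ->
  (-1) ^+ m * iter m (@dive R[i]) v (l + k)%N%:Z = (iter m dif a k)%:C.
Proof.
move=> va; elim: m k => [|m IHm] k; first by rewrite mul1r /= va.
rewrite !iterS /dive /dif.
have -> (x y : R) : (x - y)%:C = x%:C - y%:C by rewrite rmorphB.
rewrite -!IHm exprS.
rewrite (_ : (l + k)%N%:Z + 1 = (l + k.+1)%N%:Z); last by lia.
by rewrite mulN1r mulNr mulrBr opprB.
Qed.
End Bridge.

(** * Weights tested on sequences without finite support *)

Section WeightFacts.
Context {R : realType} (p : R) (l : nat).
Hypothesis p1 : 1 < p.
Implicit Types (u : int -> R[i]) (rho f w : nat -> R) (N n k : nat).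

Lemma birman_lhs_le u (x : \bar R) :
  (forall N, ((\sum_(k < N) cmod (iter l (@nabla R[i]) u (l + k)%N%:Z) `^ p)%:E <= x)%E) ->
  (birman_lhs p l u <= x)%E.
Proof.
by apply: nneseries_shift_le => n _; exact: powR_ge0.
Qed.

Lemma birman_lhs_ge u N :
  ((\sum_(k < N) cmod (iter l (@nabla R[i]) u (l + k)%N%:Z) `^ p)%:E <= birman_lhs p l u)%E.
Proof.
apply: (@nneseries_shift_ge _ (fun n => cmod (iter l (@nabla R[i]) u n%:Z) `^ p)) => n _.
exact: powR_ge0.
Qed.

Lemma birman_rhs_le rho u (x : \bar R) : (forall n, (l <= n)%N -> 0 <= rho n) ->
  (forall N, ((\sum_(k < N) rho (l + k)%N * cmod (u (l + k)%N%:Z) `^ p)%:E <= x)%E) ->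
  (birman_rhs p l rho u <= x)%E.
Proof.
move=> rho0; apply: nneseries_shift_le => n ln.
by rewrite mulr_ge0 ?powR_ge0 ?rho0.
Qed.

Lemma birman_rhs_ge rho u N : (forall n, (l <= n)%N -> 0 <= rho n) ->
  ((\sum_(k < N) rho (l + k)%N * cmod (u (l + k)%N%:Z) `^ p)%:E <= birman_rhs p l rho u)%E.
Proof.
move=> rho0; apply: (@nneseries_shift_ge _ (fun n => rho n * cmod (u n%:Z) `^ p)) => n ln.
by rewrite mulr_ge0 ?powR_ge0 ?rho0.
Qed.

Lemma birman_lhs_extend_le w (x : R) :
  (forall N, \sum_(k < N) `|iter l nab w k| `^ p <= x) ->
  (birman_lhs p l (extend l w) <= x%:E)%E.
Proof.
move=> H; apply: birman_lhs_le => N; rewrite lee_fin; apply: le_trans (H N).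
by rewrite le_eqVlt; apply/orP; left; apply/eqP; apply: eq_bigr => k _; rewrite cmod_iter_nabla_extend.
Qed.

Lemma birman_rhs_extend_ge rho w N : (forall n, (l <= n)%N -> 0 <= rho n) ->
  ((\sum_(k < N) rho (l + k)%N * `|w k| `^ p)%:E <= birman_rhs p l rho (extend l w))%E.
Proof.
move=> rho0; apply: le_trans (birman_rhs_ge _ _ N rho0).
rewrite lee_fin le_eqVlt; apply/orP; left; apply/eqP; apply: eq_bigr => k _.
by rewrite -/(restrict l (extend l w) k) restrict_extend cmod_real.
Qed.

(** Bernoulli's inequality, as nonnegativity of [young_gap p (1 - x) 1]. *)
Lemma powR_onem_ge (x : R) : 0 <= x <= 1 -> 1 - p * x <= (1 - x) `^ p.
Proof.
move=> /andP[x0 x1]; have x'0 : 0 <= 1 - x by lra.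
have := young_gap_ge0 p _ 1 p1 x'0 ler01.
by rewrite /young_gap !powR1; lra.
Qed.

(** A weight is tested only on finitely supported sequences; [cutoff_approx] extends its inequality
    to [S^l f] with [f] in [l^p], at a cost that vanishes with [eta]. *)
Lemma weight_iter_psum rho f (B : R) N : (0 < l)%N -> is_HRB_weight p l rho ->
  (forall i, 0 <= f i) -> (forall N, \sum_(i < N) f i `^ p <= B) ->
  \sum_(k < N) rho (l + k)%N * iter l psum f k `^ p <= B.
Proof.
move=> l0 [rho0 hardy] f0 fB; set S := \sum_(k < N) _.
have S0 : 0 <= S.
  by apply: sumr_ge0 => k _; rewrite mulr_ge0 ?powR_ge0// rho0// leq_addr.
have B0 : 0 <= B by have := fB 0%N; rewrite big_ord0.
have p0 : 0 < p by exact: lt_trans p1.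
have key eta : 0 < eta < 1 -> (1 - p * eta) * S <= (1 + eta) * B + eta.
  move=> /andP[eta0 eta1].
  have [z [z01 [M zM] zN zB]] := cutoff_approx p l f B eta N p1 l0 f0 fB eta0.
  pose w k := z k * iter l psum f k.
  have w0 k : 0 <= w k.
    by have /andP[? _] := z01 k; rewrite mulr_ge0// iter_psum_ge0.
  have : H0seq l (extend l w).
    apply: (@H0seq_extend _ l l w M) => // [k|k kM]; first by rewrite ltnNge leq_addr.
    by rewrite /w zM// mul0r.
  move=> /hardy H.
  have := le_trans (birman_rhs_extend_ge _ w N rho0) (le_trans H (birman_lhs_extend_le _ _ zB)).
  rewrite lee_fin; apply: le_trans.
  rewrite mulr_sumr; apply: ler_sum => k _.
  have u0 : 0 <= iter l psum f k by exact: iter_psum_ge0.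
  have z0 := z01 k; have zk := zN k (ltn_ord k).
  rewrite ger0_norm// /w powRM//; last by case/andP: z0.
  rewrite mulrCA ler_wpM2l ?rho0 ?leq_addr// ler_wpM2r ?powR_ge0//.
  apply: le_trans (powR_onem_ge eta _) _; first by rewrite !ltW.
  by apply: ge0_ler_powR; rewrite ?nnegrE ?(ltW p0) ?subr_ge0 ?(ltW eta1)//; case/andP: z0.
rewrite leNgt; apply/negP => BS.
pose c := p * S + B + 1.
have c0 : 0 < c by rewrite ltr_pwDr// addr_ge0// mulr_ge0// ltW.
have c1 : 1 <= c by rewrite lerDr addr_ge0// mulr_ge0// ltW.
(* [key] rearranges to [S - B <= eta * c], whereas this choice gives [eta * c <= (S - B) / 2]. *)
pose eta := Num.min 2^-1 ((S - B) / (2 * c)).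
have eta0 : 0 < eta by rewrite lt_min invr_gt0 ltr0n divr_gt0 ?subr_gt0 ?mulr_gt0.
have eta1 : eta < 1 by rewrite gt_min invf_lt1 ?ltr1n.
have etac : eta * c <= (S - B) / 2.
  by rewrite -ler_pdivlMr// -mulrA -invfM; rewrite ge_min lexx orbT.
have := key eta; rewrite eta0 eta1 => /(_ isT).
by rewrite /c in etac; lra.
Qed.
End WeightFacts.

(** * The weight property and the three parts of optimality *)

Section Optimal.
Context {R : realType} (p : R) (l : nat) (F rho : nat -> R).
Let G := iter l psum F.
Let A n := F n `^ (p - 1).
Let b := iter l dif A.
Hypotheses (p1 : 1 < p) (l0 : (0 < l)%N) (F0 : forall n, 0 < F n).
Hypotheses (dA : forall j n, (0 < j <= l)%N -> 0 <= iter j dif A n).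
Hypothesis b1 : forall n, 0 < b n.
Hypothesis G_le : exists C, forall n, G n <= C * n.+1%:R `^ (l%:R - p^-1).
Hypothesis G_ge : exists2 c, 0 < c & \forall n \near \oo, c * n.+1%:R `^ (l%:R - p^-1) <= G n.
Hypothesis rhoE : forall k, rho (l + k)%N = b k / G k `^ (p - 1).
Implicit Types (u : int -> R[i]) (t f w : nat -> R) (N n k m : nat).

Let p0 : 0 < p := lt_trans ltr01 p1.
Let G0 n : 0 < G n := iter_psum_gt0 l F F0 n.

Let rhok0 k : 0 <= rho (l + k)%N.
Proof. by rewrite rhoE divr_ge0 ?powR_ge0// ltW. Qed.

Let rho0 n : (l <= n)%N -> 0 <= rho n.
Proof. by move=> ln; rewrite -(subnKC ln). Qed.

Let hardy f N : (forall i, 0 <= f i) ->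
  \sum_(k < N) rho (l + k)%N * (iter l psum f k) `^ p <= \sum_(i < N) f i `^ p.
Proof.
move=> f0; apply: le_trans (hardy_partial p l F p1 l0 F0 dA f N f0).
by rewrite le_eqVlt; apply/orP; left; apply/eqP; apply: eq_bigr => k _; rewrite rhoE.
Qed.

Let rhs_le u N : Hseq l u ->
  \sum_(k < N) rho (l + k)%N * cmod (u (l + k)%N%:Z) `^ p <=
  \sum_(k < N) rho (l + k)%N *
    (iter l psum (fun i => cmod (iter l (@nabla R[i]) u (l + i)%N%:Z)) k) `^ p.
Proof.
move=> u0; apply: ler_sum => k _; rewrite ler_wpM2l// ge0_ler_powR ?(ltW p0)//.
- by rewrite nnegrE cmod_ge0.
- by rewrite nnegrE iter_psum_ge0// => i _; exact: cmod_ge0.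
- exact: cmod_le_iter_psum.
Qed.

Lemma profile_is_weight : is_HRB_weight p l rho.
Proof.
split=> // u [u0 _]; apply: birman_rhs_le => // N.
apply: le_trans (birman_lhs_ge p l u N); rewrite lee_fin.
apply: le_trans (rhs_le u N u0) _; apply: hardy => i; exact: cmod_ge0.
Qed.

(** Passing to the moduli [f] of the [l]-th difference keeps the left side and can only raise the
    right side, so equality persists and [f = c * F]. Divergence of the energy of [F] excludes
    [c > 0], and [|u| <= S^l f] then vanishes. *)
Lemma profile_non_attainable : non_attainable p l rho.
Proof.
move=> u u0 lr rfin n.
pose f i := cmod (iter l (@nabla R[i]) u (l + i)%N%:Z).
have f0 i : 0 <= f i by exact: cmod_ge0.
have Rge0 : (0 <= birman_rhs p l rho u)%E.
  by have := birman_rhs_ge p l rho u 0 rho0; rewrite big_ord0.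
have Rfin : birman_rhs p l rho u \is a fin_num by rewrite ge0_fin_numE.
pose L := fine (birman_rhs p l rho u).
have RL : birman_rhs p l rho u = L%:E by rewrite fineK.
have fL N : \sum_(i < N) f i `^ p <= L.
  by rewrite -lee_fin -RL -lr; exact: birman_lhs_ge.
have Lrho e : 0 < e -> exists N, L - e < \sum_(n < N) b n / G n `^ (p - 1) * (iter l psum f n) `^ p.
  move=> e0; apply: contrapT => /forallNP H.
  suff : (birman_rhs p l rho u <= (L - e)%:E)%E by rewrite RL lee_fin; lra.
  apply: birman_rhs_le => // N; rewrite lee_fin.
  have := H N => /negP; rewrite -leNgt; apply: le_trans.
  apply: le_trans (rhs_le u N u0) _.
  by apply: ler_sum => k _; rewrite rhoE.
have [c c0 fc] := hardy_equality p l F p1 l0 F0 dA f L f0 b1 fL Lrho.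
have c00 : c = 0.
  apply/eqP; apply: contraT => cn0.
  have cp : 0 < c by rewrite lt_def cn0.
  have [N] := profile_energy_unbounded p l F p1 l0 F0 G_ge (L / c `^ p).
  rewrite ltNge ler_pdivlMr ?powR_gt0// mulr_suml => /negP[].
  apply: le_trans (fL N); apply: ler_sum => i _.
  by rewrite fc powRM ?(ltW (F0 _))// mulrC.
have [ln|nl] := leP l%:Z n; last exact: u0.
have -> : n = (l + `|n - l%:Z|)%N%:Z by lia.
apply: ComplexField.Normc.eq0_normc; apply/eqP; rewrite eq_le cmod_ge0 andbT.
apply: le_trans (cmod_le_iter_psum l u _ u0) _.
rewrite -/f (_ : f = fun=> 0); first by rewrite iter_psum0.
by apply/funext => i; rewrite fc c00 mul0r.
Qed.

(** The least upper bound is needed: the contradictions below come from a strictly smaller bound. *)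
Let slow_energy_sup e : 0 < e -> exists B,
  (forall N, \sum_(i < N) (F i * slow_decay e i) `^ p <= B) /\
  forall B', (forall N, \sum_(i < N) (F i * slow_decay e i) `^ p <= B') -> B <= B'.
Proof.
move=> e0; have [C C0 HC] := slow_decay_energy p l F p1 l0 F0 dA G_le.
pose s N := \sum_(i < N) (F i * slow_decay e i) `^ p.
have snd : nondecreasing_seq s.
  by apply/nondecreasing_seqP => n; rewrite /s big_ord_recr /= lerDl powR_ge0.
have scv : cvgn s.
  apply: nondecreasing_is_cvgn => //; exists (C * (1 + (p * e)^-1)) => _ [n _ <-]; exact: HC.
exists (limn s); split=> [N|B' HB']; first exact: nondecreasing_cvgn_le.
by apply: limr_le => //; exact: nearW.
Qed.

Let small_exponent (x : R) : 0 < x -> exists e,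
  [/\ 0 < e <= 1, p * e <= (1 - p^-1) / 4 & e <= x].
Proof.
have q0 : 0 < 1 - p^-1 by rewrite subr_gt0 invf_lt1.
move=> x0; exists (Num.min 1 (Num.min x ((1 - p^-1) / 4 / p))); split.
- by rewrite !lt_min ltr01 x0 !divr_gt0//= ge_min lexx.
- by rewrite -ler_pdivlMl// mulrC !ge_min lexx !orbT.
- by rewrite !ge_min lexx orbT.
Qed.

Let slow_ge0 e i : 0 <= F i * slow_decay e i.
Proof. by rewrite mulr_ge0 ?powR_ge0// ltW. Qed.

(** A surplus of [rho'] at one index lowers the bound on the [rho]-sums by an amount [v] independent
    of [e]. [slow_decay_deficit] then bounds the energy by [B - v + K * e], below its supremum [B]
    for small [e]. *)
Lemma profile_critical : critical p l rho.
Proof.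
move=> rho' wrho' rho_le n ln; apply/eqP; apply: contraT => neq.
pose m := (n - l)%N; have nE : n = (l + m)%N by rewrite /m subnKC.
have rl := rho_le n ln.
pose d := rho' n - rho n.
have d0 : 0 < d by rewrite subr_gt0 lt_def rl neq.
have [K K0 HK] := slow_decay_deficit p l F p1 l0 F0 dA G_le.
(* For [e <= 1] and [i <= m] the multiplier is at least [1 / (m + 1)], so [u m >= G m / (m + 1)]
   uniformly in [e]. *)
pose v := d * (G m / m.+1%:R) `^ p.
have v0 : 0 < v by rewrite mulr_gt0// powR_gt0// divr_gt0.
have x0 : 0 < v / (2 * K) by rewrite divr_gt0// mulr_gt0.
have [e [/andP[e0 e1] pe ex]] := small_exponent _ x0.
have [B [HB Bmin]] := slow_energy_sup _ e0.
pose u := iter l psum (fun i => F i * slow_decay e i).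
have u0 k : 0 <= u k by apply: iter_psum_ge0 => i _; exact: slow_ge0.
have rB N := weight_iter_psum p l p1 rho' _ B N l0 wrho' (slow_ge0 e) HB.
have um : (G m / m.+1%:R) `^ p <= u m `^ p.
  apply: ge0_ler_powR; rewrite ?nnegrE ?(ltW p0) ?divr_ge0 ?(ltW (G0 _))//.
  rewrite mulrC -iter_psumZ; apply: iter_psum_le => i im.
  rewrite mulrC ler_wpM2l ?(ltW (F0 _))// /slow_decay -[_^-1]powR_inv1//.
  apply: (@le_trans _ _ (i.+1%:R `^ (-1))).
    by rewrite !powR_inv1// lef_pV2 ?posrE// ler_nat.
  by rewrite ler_powR ?ler1n// lerN2.
have B' N : \sum_(k < N) b k / G k `^ (p - 1) * u k `^ p <= B - v.
  apply: (@le_trans _ _ (\sum_(k < N + m.+1) rho (l + k)%N * u k `^ p)).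
    rewrite big_split_ord /=; under eq_bigr do rewrite -rhoE.
    by rewrite lerDl sumr_ge0// => k _; rewrite mulr_ge0 ?powR_ge0.
  rewrite lerBrDr; apply: le_trans (rB (N + m.+1)%N).
  have mN : (m < N + m.+1)%N by rewrite addnS ltnS leq_addl.
  rewrite (bigD1 (Ordinal mN))//= [leRHS](bigD1 (Ordinal mN))//= addrAC lerD//.
    rewrite -nE -/u (_ : rho' n = rho n + d); last by rewrite /d addrC subrK.
    by rewrite mulrDl lerD2l /v ler_pM2l.
  by apply: ler_sum => k _; rewrite ler_wpM2r ?powR_ge0// rho_le// leq_addr.
have e01 : 0 < e <= 1 by rewrite e0.
have := Bmin _ (HK e e01 pe _ B').
have : K * e <= v / 2.
  apply: le_trans (ler_wpM2l (ltW K0) ex) _.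
  by rewrite le_eqVlt; apply/orP; left; apply/eqP; field; rewrite gt_eqF.
by move: (K * e) => y; lra.
Qed.

(** The test sequence is [S^l (F * slow_decay e)], cut off far out and set to zero below [m]. All
    losses are bounded independently of [e], while the energy [B] grows without bound as [e] tends
    to 0. *)
Lemma profile_optimal_near_infinity : optimal_near_infinity p l rho.
Proof.
move=> m eps lm eps0.
have [K K0 HK] := slow_decay_deficit p l F p1 l0 F0 dA G_le.
pose m0 := (m - l)%N.
(* Each difference at most doubles a bound, so [H] controls the [l]-th difference up to index
   [m0 + l]; from there on, setting the first [m0] entries to zero has no effect on it. *)
pose H := 2 ^+ l * psum G (m0 + l).
pose C1 := (m0 + l)%:R * H `^ p.
pose C2 := \sum_(k < m0) rho (l + k)%N * G k `^ p.
(* [B > Y] implies the final comparison [C1 + B + 2 < (1 + eps) * (B - K - 2 - C2)]. *)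
pose Y := (C1 + 2 + (1 + eps) * (K + 3 + C2)) / eps.
have [N1 HN1] := profile_energy_unbounded p l F p1 l0 F0 G_ge (2 * Y).
(* For [i < N1] this gives [(i + 1) ^ (p * e) <= 2 ^ ((N1 + 1) * p * e) <= 2], so at least half of
   the first [N1] terms of the energy survives. *)
have [e [/andP[e0 e1] pe ex]] : exists e,
   [/\ 0 < e <= 1, p * e <= (1 - p^-1) / 4 & e <= (p * N1.+1%:R)^-1].
  by apply: small_exponent; rewrite invr_gt0 mulr_gt0.
have [B [HB Bmin]] := slow_energy_sup _ e0.
have YB : Y < B.
  apply: lt_le_trans (HB N1).
  suff : \sum_(i < N1) F i `^ p <= 2 * \sum_(i < N1) (F i * slow_decay e i) `^ p.
    by move=> /(lt_le_trans HN1); rewrite ltr_pM2l.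
  rewrite mulr_sumr; apply: ler_sum => i _.
  rewrite powRM ?powR_ge0 ?(ltW (F0 _))// mulrCA ler_peMr ?powR_ge0//.
  rewrite /slow_decay -powRrM mulNr powRN ler_pdivlMr ?powR_gt0// mul1r.
  apply: (@le_trans _ _ ((2 ^+ N1.+1) `^ (e * p))).
    apply: ge0_ler_powR; rewrite ?nnegrE ?exprn_ge0 ?mulr_ge0 ?(ltW e0) ?(ltW p0)//.
    by rewrite -natrX ler_nat (leq_trans (ltnW (ltn_expl _ (ltnSn 1))))// leq_exp2l// ltnS ltnW.
  rewrite -powR_mulrn// -powRrM -[leRHS]powRr1// ler_powR ?ler1n//.
  rewrite (_ : _ * (e * p) = e * (p * N1.+1%:R)); last by rewrite mulrC mulrA.
  by rewrite -ler_pdivlMr ?mulr_gt0// div1r.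
have B0 : 0 <= B by have := HB 0%N; rewrite big_ord0.
(* Makes both [eta * B] and [p * eta * B] at most 1, so the cutoff costs only bounded amounts. *)
pose eta := (1 + p * B)^-1.
have den0 : 0 < 1 + p * B by rewrite ltr_pwDl// mulr_ge0// ltW.
have eta0 : 0 < eta by rewrite invr_gt0.
have eta1 : eta <= 1 by rewrite invf_le1// lerDl mulr_ge0// ltW.
have petaB : p * eta * B <= 1.
  by rewrite mulrAC ler_pdivrMr// mul1r lerDr.
have etaB : eta * B <= 1.
  by rewrite mulrC ler_pdivrMr// mul1r -[leLHS]add0r lerD// ler_peMl// ltW.
have e01 : 0 < e <= 1 by rewrite e0.
pose f i := F i * slow_decay e i; pose u := iter l psum f.
have f0 i : 0 <= f i by exact: slow_ge0.
have u0 k : 0 <= u k by apply: iter_psum_ge0 => i _; exact: slow_ge0.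
have uG k : u k <= G k.
  apply: iter_psum_le => i _; rewrite /f ler_piMr ?(ltW (F0 _))//.
  by rewrite /slow_decay -[leRHS](powRr0 i.+1%:R) ler_powR ?ler1n// oppr_le0 ltW.
(* Otherwise [slow_decay_deficit] would bound the energy by [B - K - 1 + K * e <= B - 1]. *)
have [N2 HN2] : exists N, B - K - 1 < \sum_(k < N) rho (l + k)%N * u k `^ p.
  apply: contrapT => /forallNP HN.
  have rB N : \sum_(k < N) b k / G k `^ (p - 1) * u k `^ p <= B - K - 1.
    have /negP := HN N; rewrite -leNgt; under eq_bigr do rewrite rhoE; exact.
  have := Bmin _ (HK e e01 pe _ rB).
  have : K * e <= K by rewrite ler_piMr// ltW.
  by move: (K * e) => y; lra.
have [z [z01 [M zM] zN zB]] := cutoff_approx p l f B eta N2 p1 l0 f0 HB eta0.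
pose w k := z k * u k.
have w0 k : 0 <= w k by have /andP[? _] := z01 k; rewrite mulr_ge0.
have wG k : w k <= G k.
  have /andP[? ?] := z01 k; apply: le_trans (uG k); rewrite ler_piMl//.
pose w' k := if (m0 <= k)%N then w k else 0.
exists (extend l w'); split.
  apply: (@H0seq_extend _ l m w' M) => // k.
    by move=> km; rewrite /w' leqNgt /m0 ltn_subRL km.
  by move=> Mk; rewrite /w' /w zM// mul0r if_same.
have tail j k : (m0 + j <= k)%N -> iter j nab w' k = iter j nab w k.
  elim: j k => [|j IHj] k; first by rewrite addn0 /= /w' => ->.
  by rewrite !iterS addnS; case: k => [//|k]; rewrite ltnS => mk /=; rewrite !IHj// leqW.
have head j k : (k <= m0 + l)%N -> `|iter j nab w' k| <= 2 ^+ j * psum G (m0 + l).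
  elim: j k => [|j IHj] k km.
    rewrite expr0 mul1r /= /w'; apply: (@le_trans _ _ (G k)).
      by case: ifP => _; rewrite ?normr0 ?(ltW (G0 _))// ger0_norm.
    by apply: psum_ge_term => // i; exact: ltW.
  have P0 : 0 <= 2 ^+ j * psum G (m0 + l).
    by rewrite mulr_ge0 ?exprn_ge0// (iter_psum_ge0 1)// => i _; exact: ltW.
  rewrite iterS exprS -mulrA; case: k km => [|k] km /=.
    by apply: le_trans (IHj _ _) _ => //; rewrite ler_peMl// ler1n.
  apply: le_trans (ler_normB _ _) _; rewrite mulr_natl mulr2n lerD// IHj//.
  exact: ltnW.
have lhsw : (birman_lhs p l (extend l w') <= (C1 + ((1 + eta) * B + eta))%:E)%E.
  apply: birman_lhs_extend_le => N.
  apply: (@le_trans _ _ (\sum_(k < (m0 + l) + N) `|iter l nab w' k| `^ p)).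
    by rewrite addnC big_split_ord /= lerDl sumr_ge0// => k _; exact: powR_ge0.
  rewrite big_split_ord /= lerD//.
    apply: (@le_trans _ _ (\sum_(k < m0 + l) H `^ p)).
      apply: ler_sum => k _; apply: ge0_ler_powR; rewrite ?nnegrE ?(ltW p0)//.
        by rewrite mulr_ge0 ?exprn_ge0// (iter_psum_ge0 1)// => i _; exact: ltW.
      by apply: head; exact: ltnW.
    by rewrite sumr_const card_ord /C1 mulr_natl.
  apply: le_trans (zB (m0 + l + N)%N); rewrite big_split_ord /=.
  rewrite -[leLHS]add0r lerD//; first by apply: sumr_ge0 => k _; exact: powR_ge0.
  by apply: ler_sum => k _; rewrite tail// leq_addr.
have rhsw : ((B - K - 2 - C2)%:E <= birman_rhs p l rho (extend l w'))%E.
  apply: le_trans (birman_rhs_extend_ge p l rho w' (m0 + N2) rho0).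
  rewrite lee_fin lerBlDr.
  have S1 : \sum_(k < N2) rho (l + k)%N * u k `^ p <= B.
    by apply: le_trans (hardy f N2 f0) (HB N2).
  have S2 : B - K - 2 <= \sum_(k < N2) rho (l + k)%N * w k `^ p.
    set S := \sum_(k < N2) rho (l + k)%N * u k `^ p in HN2 S1.
    apply: (@le_trans _ _ ((1 - p * eta) * S)).
      have : p * eta * S <= 1.
        by apply: le_trans petaB; rewrite ler_wpM2l// mulr_ge0// ltW.
      by rewrite mulrBl mul1r; clearbody S; lra.
    rewrite /S mulr_sumr; apply: ler_sum => k _.
    have /andP[zk0 _] := z01 k.
    rewrite /w powRM// mulrCA ler_wpM2l// ler_wpM2r ?powR_ge0//.
    apply: le_trans (powR_onem_ge p p1 eta _) _; first by rewrite ltW.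
    by apply: ge0_ler_powR; rewrite ?nnegrE ?(ltW p0) ?subr_ge0//; exact: zN.
  apply: le_trans S2 _.
  apply: (@le_trans _ _ (\sum_(k < m0 + N2) rho (l + k)%N * w k `^ p)).
    by rewrite addnC big_split_ord /= lerDl sumr_ge0// => k _; rewrite mulr_ge0 ?powR_ge0.
  rewrite !big_split_ord /= addrC; apply: lerD.
    rewrite -[leLHS]add0r; apply: lerD.
      by apply: sumr_ge0 => k _; rewrite mulr_ge0 ?powR_ge0.
    by apply: ler_sum => k _; rewrite /w' leq_addr ger0_norm.
  apply: ler_sum => k _; rewrite ler_wpM2l// ge0_ler_powR ?nnegrE ?(ltW p0) ?(ltW (G0 _))//.
apply: le_lt_trans lhsw _.
apply: lt_le_trans (_ : (((1 + eps) * (B - K - 2 - C2))%:E <= _)%E); last first.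
  by rewrite EFinM lee_wpmul2l// lee_fin addr_ge0// ltW.
rewrite lte_fin.
have HY : C1 + 2 + (1 + eps) * (K + 3 + C2) < eps * B.
  by rewrite -ltr_pdivrMl// mulrC.
rewrite mulrDl mul1r; move: (eta * B) etaB HY => x; lra.
Qed.
End Optimal.

(** * Two-sided bounds from the asymptotic expansion *)

Section Asymptotics.
Context {R : realType}.
Implicit Types (v w : nat -> R) (N n k l : nat).

Lemma near_le_all v w (C : R) : (forall n, 0 <= v n) -> (forall n, 0 < w n) ->
  (\forall n \near \oo, v n <= C * w n) -> exists C', forall n, v n <= C' * w n.
Proof.
move=> v0 w0 [N _ H].
pose C' := `|C| + \sum_(i < N) v i / w i.
exists C' => n; have [nN|Nn] := ltnP n N.
  rewrite -ler_pdivrMr// /C' (bigD1 (Ordinal nN))//= addrCA lerDl addr_ge0//.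
  by rewrite sumr_ge0// => i _; rewrite divr_ge0// ltW.
apply: le_trans (H n Nn) _; rewrite ler_pM2r// /C'.
apply: le_trans (ler_norm C) _; rewrite lerDl sumr_ge0// => i _.
by rewrite divr_ge0// ltW.
Qed.

(** The lower terms and the remainder have exponents at most [s - 1]; together they are at most half
    the leading term once [n] is large. *)
Lemma asymptotic_leading (v : nat -> R[i]) (alpha : nat -> R) (s t : R) (m : nat) :
  alpha 0%N != 0 -> t <= s - 1 ->
  (fun n : nat => cmod (v n - (\sum_(0 <= j < m.+1) alpha j * n%:R `^ (s - j%:R))%:C) : R)
    =O_\oo (fun n : nat => n%:R `^ t : R) ->
  \forall n \near \oo, `|alpha 0%N| / 2 * n%:R `^ s <= cmod (v n) <= 2 * `|alpha 0%N| * n%:R `^ s.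
Proof.
move=> a0 ts /eqO_exP [C C0 HC].
pose K := \sum_(0 <= j < m) `|alpha j.+1| + C.
have aa0 : 0 < `|alpha 0%N| by rewrite normr_gt0.
near=> n.
have n1 : 1 <= n%:R :> R by rewrite ler1n; near: n; exact: nbhs_infty_gt.
have n0 : 0 < n%:R :> R by apply: lt_le_trans n1.
have Kn : K / (`|alpha 0%N| / 2) <= n%:R by near: n; exact: nbhs_infty_ger.
have err : cmod (v n - (\sum_(0 <= j < m.+1) alpha j * n%:R `^ (s - j%:R))%:C) <= C * n%:R `^ t.
  near: n; apply: filterS HC => i.
  by rewrite ger0_norm ?cmod_ge0// ger0_norm ?powR_ge0.
rewrite big_nat_recl//= subr0 rmorphD /= in err.
set P := n%:R `^ s in err *.
have P0 : 0 < P by exact: powR_gt0.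
set T := \sum_(0 <= j < m) _ in err.
have nV (x : R) : x <= s - 1 -> n%:R `^ x <= P / n%:R.
  move=> xs; rewrite /P -[in leRHS](powR_inv1 (ltW n0)) -powR_add//.
  by rewrite ler_powR.
have Tle : `|T| <= (\sum_(0 <= j < m) `|alpha j.+1|) * (P / n%:R).
  rewrite /T mulr_suml; apply: le_trans (ler_norm_sum _ _ _) _.
  apply: ler_sum => j _; rewrite normrM ler_wpM2l// ger0_norm ?powR_ge0//.
  by apply: nV; rewrite lerD2l lerN2 ler1n.
have KP : K * (P / n%:R) <= `|alpha 0%N| / 2 * P.
  rewrite mulrCA [leRHS]mulrC ler_pM2l// ler_pdivrMr// [leRHS]mulrC.
  by rewrite -ler_pdivrMr ?divr_gt0.
have {}err : cmod (v n - ((alpha 0%N * P)%:C + T%:C)) <= C * (P / n%:R).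
  by apply: le_trans err _; rewrite ler_wpM2l ?(ltW C0)// nV.
have rest : cmod (v n - (alpha 0%N * P)%:C) <= `|alpha 0%N| / 2 * P.
  apply: le_trans KP; rewrite (_ : v n - _ = v n - ((alpha 0%N * P)%:C + T%:C) + T%:C).
    apply: le_trans (cmodD _ _) _; rewrite cmod_real /K mulrDl addrC; exact: lerD.
  by rewrite opprD addrA subrK.
have aP : cmod (alpha 0%N * P)%:C = `|alpha 0%N| * P.
  by rewrite cmod_real normrM (ger0_norm (ltW P0)).
apply/andP; split.
  have := cmodB (v n) (v n - (alpha 0%N * P)%:C).
  rewrite opprB addrCA subrr addr0 aP; lra.
have := cmodD (v n - (alpha 0%N * P)%:C) (alpha 0%N * P)%:C.
have := mulr_gt0 aa0 P0.
rewrite subrK aP; lra.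
Unshelve. all: by end_near. Qed.

Lemma gt0_complex_real (z : R[i]) : 0 < z -> z = (complex.Re z)%:C /\ 0 < complex.Re z.
Proof. by case: z => x y; rewrite ltcE /= => /andP[/eqP -> ->]. Qed.
End Asymptotics.

(* In R[i], [0 < z] (resp. [0 <= z]) means that z is real and positive
   (resp. non-negative). *)
Theorem theorem2p8 (R : realType) (l : nat) (p : R) (g : int -> R[i])
    (alpha : nat -> R) :
  (0 < l)%N -> 1 < p ->
  Hseq l g ->
  (forall n k : nat, (l <= n)%N -> (k <= l)%N ->
     0 < iter k (@nabla R[i]) g n%:Z) ->
  (forall n k : nat, (l <= n)%N -> (0 < k)%N -> (k < l)%N ->
     0 <= pLap p (l - k) (iter k (@nabla R[i]) g) n%:Z) ->
  (forall n : nat, (l <= n)%N -> 0 < pLap p l g n%:Z) ->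
  alpha 0%N != 0 ->
  (fun n : nat => cmod (g n%:Z -
      (\sum_(0 <= j < (2 * l).+1)
          alpha j * n%:R `^ (l%:R - j%:R - p^-1))%:C) : R)
    =O_\oo (fun n : nat => n%:R `^ (- l%:R - 1 - p^-1) : R) ->
  is_optimal_HRB_weight p l (rho_of p l g).
Proof.
move=> l0 p1 gH gpos lap_ge0 lap_gt0 a0 gO.
have p0 : 0 < p by apply: lt_trans p1.
have pm0 : 0 < p - 1 by rewrite subr_gt0.
have pV1 : p^-1 < 1 by rewrite invf_lt1.
pose F k := complex.Re (iter l (@nabla R[i]) g (l + k)%N%:Z).
have FE k : iter l (@nabla R[i]) g (l + k)%N%:Z = (F k)%:C.
  by have [] := gt0_complex_real _ (gpos (l + k)%N l (leq_addr _ _) (leqnn l)).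
have F0 k : 0 < F k.
  by have [] := gt0_complex_real _ (gpos (l + k)%N l (leq_addr _ _) (leqnn l)).
pose G := iter l psum F.
have GE k : g (l + k)%N%:Z = (G k)%:C.
  pose h k := complex.Re (g (l + k)%N%:Z).
  have hE i : g (l + i)%N%:Z = (h i)%:C.
    by have [] := gt0_complex_real _ (gpos (l + i)%N 0%N (leq_addr _ _) (leq0n l)).
  suff -> : G = h by exact: hE.
  rewrite /G -[RHS](iter_nabK l); congr (iter l psum _); apply/funext => i.
  have : (iter l nab h i)%:C = (F i)%:C.
    rewrite -iter_nabla_real -FE -/(restrict l _ i) restrict_iter_nabla//.
    by congr (iter l nab _ i); apply/funext => j; rewrite -hE.
  by move=> /(congr1 (@complex.Re R)) /=.
have G0 k : 0 < G k := iter_psum_gt0 l F F0 k.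
pose A n := F n `^ (p - 1).
(* Since [nabla^m] of [nabla^j g] is [nabla^l g], every operator in the hypotheses acts on the same
   sequence [A]; taking [k = l - j] gives the sign of its [j]-th difference. *)
have lapE m k j : (m + j = l)%N ->
    pLap p m (iter j (@nabla R[i]) g) (l + k)%N%:Z = (iter m dif A k)%:C.
  move=> mj; apply: dive_iter_real => n.
  by rewrite -iterD mj FE signed_pow_real// ltW.
have b1 n : 0 < iter l dif A n.
  have := lap_gt0 (l + n)%N (leq_addr _ _).
  by rewrite (lapE l n 0%N (addn0 l)) ltcR.
have dA j n : (0 < j <= l)%N -> 0 <= iter j dif A n.
  move=> /andP[j0]; rewrite leq_eqVlt => /predU1P[->|jl]; first exact/ltW.
  have jk : (l - (l - j))%N = j by rewrite subKn// ltnW.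
  have := lap_ge0 (l + n)%N (l - j)%N (leq_addr _ _).
  rewrite subn_gt0 jl jk => /(_ isT); rewrite ltn_subrL j0 l0 => /(_ isT).
  by rewrite (lapE j n (l - j)%N (subnKC (ltnW jl))) lecR.
pose s := l%:R - p^-1.
have s0 : 0 <= s by rewrite subr_ge0 (le_trans (ltW pV1))// ler1n.
have gasym : \forall n \near \oo, `|alpha 0%N| / 2 * n%:R `^ s <= cmod (g n%:Z)
      <= 2 * `|alpha 0%N| * n%:R `^ s.
  apply: (@asymptotic_leading R (fun n => g n%:Z) alpha s (- l%:R - 1 - p^-1) (2 * l)) => //.
    by rewrite /s; have := ler0n R l; lra.
  rewrite (_ : (fun n => _) = (fun n : nat => cmod (g n%:Z -
      (\sum_(0 <= j < (2 * l).+1)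
          alpha j * n%:R `^ (l%:R - j%:R - p^-1))%:C) : R))//.
  apply/funext => n; congr (cmod (_ - (_)%:C)); apply: eq_bigr => j _.
  by rewrite /s addrAC.
have Gasym : \forall k \near \oo, `|alpha 0%N| / 2 * (l + k)%:R `^ s <= G k
      <= 2 * `|alpha 0%N| * (l + k)%:R `^ s.
  have [N _ HN] := gasym; exists N => // k /= Nk.
  have := HN (l + k)%N; rewrite /= GE cmod_real (ger0_norm (ltW (G0 _))).
  by apply; rewrite (leq_trans Nk)// leq_addl.
have G_le : exists C, forall n, G n <= C * n.+1%:R `^ (l%:R - p^-1).
  (* The factor [l ^ s] comes from [l + k <= l * (k + 1)]. *)
  apply: (@near_le_all _ _ _ (2 * `|alpha 0%N| * l%:R `^ s)) => [n|n|].
  - exact: ltW.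
  - exact: powR_gt0.
  near=> k; have /andP[_] : `|alpha 0%N| / 2 * (l + k)%:R `^ s <= G k
      <= 2 * `|alpha 0%N| * (l + k)%:R `^ s by near: k.
  move=> /le_trans; apply; rewrite -[leRHS]mulrA ler_wpM2l//.
  rewrite -powRM//; apply: ge0_ler_powR; rewrite ?nnegrE ?mulr_ge0//.
  by rewrite -natrM ler_nat mulnS leq_add2l leq_pmull.
have G_ge : exists2 c, 0 < c & \forall n \near \oo, c * n.+1%:R `^ (l%:R - p^-1) <= G n.
  exists (`|alpha 0%N| / 2); first by rewrite divr_gt0// normr_gt0.
  near=> k; have /andP[+ _] : `|alpha 0%N| / 2 * (l + k)%:R `^ s <= G k
      <= 2 * `|alpha 0%N| * (l + k)%:R `^ s by near: k.
  apply: le_trans; rewrite ler_wpM2l ?divr_ge0//.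
  by apply: ge0_ler_powR; rewrite ?nnegrE// ler_nat -add1n leq_add2r.
have rhoE k : rho_of p l g (l + k)%N = iter l dif A k / G k `^ (p - 1).
  by rewrite /rho_of (lapE l k 0%N (addn0 l)) GE.
split.
- exact: profile_is_weight p1 l0 F0 dA b1 rhoE.
- exact: profile_critical p1 l0 F0 dA b1 G_le rhoE.
- exact: profile_non_attainable p1 l0 F0 dA b1 G_ge rhoE.
- exact: profile_optimal_near_infinity p1 l0 F0 dA b1 G_le G_ge rhoE.
Unshelve. all: by end_near. Qed.
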